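(* Let $\mathcal{P}$ be a finite polysquare translation surface, and let $\mathcal{M}=\mathcal{P}\times[0,1)$ be the associated polycube translation $3$-manifold, the cartesian product of $\mathcal{P}$ and the unit torus $[0,1)$. Let $\mathbf{v}=(v_1,v_2)\in\mathbb{R}^2$ be the step vector of a Kronecker sequence on $\mathcal{P}$, i.e. $v_1,v_2,1$ are linearly independent over $\mathbb{Q}$. Then the following statements are equivalent: (i) The $\mathbf{v}$-shift on $\mathcal{P}$ is ergodic. (ii) For any $w\in\mathbb{R}$ such that $\mathbf{w}=(\mathbf{v},w)=(v_1,v_2,w)\in\mathbb{R}^3$ is the step vector of a Kronecker sequence on $\mathcal{M}$, i.e. such that $v_1,v_2,w,1$ are linearly independent over $\mathbb{Q}$, the $\mathbf{w}$-shift in $\mathcal{M}$ is ergodic.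
   Context: A finite polysquare translation surface $\mathcal{P}$ is a connected surface obtained from finitely many, say $s$, unit squares with sides parallel to the axes (the atomic squares) by identifying their edges in pairs by translations (right edges with left edges, top edges with bottom edges). Its singularities are the vertices with total cone angle different from $2\pi$. The manifold $\mathcal{M}=\mathcal{P}\times[0,1)$, where $[0,1)=\mathbb{R}/\mathbb{Z}$ is the unit torus, consists of $s$ atomic cubes (atomic square times $[0,1)$); its singularities are the points $(p,z)$ with $p$ a singularity of $\mathcal{P}$. Geodesics: a geodesic on $\mathcal{P}$ or $\mathcal{M}$ with a given direction is the unit speed straight line motion in that direction, continued through the identifications, as long as it does not hit a singularity. Shifts: the $\mathbf{v}$-shift on $\mathcal{P}$ is the (almost everywhere defined, Lebesgue measure preserving) map sending $\mathbf{x}$ to $\mathbf{x}+\mathbf{v}$, the endpoint of the geodesic segment of length $|\mathbf{v}|$ starting at $\mathbf{x}$ in the direction $\mathbf{v}$. The $\mathbf{w}$-shift in $\mathcal{M}$ is defined analogously; explicitly it sends $(\mathbf{x},z)$ to $(\mathbf{x}+\mathbf{v},\{z+w\})$, where $\{\cdot\}$ is the fractional part. Ergodicity is with respect to $2$-dimensional Lebesgue measure on $\mathcal{P}$ and $3$-dimensional Lebesgue measure on $\mathcal{M}$. *)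

(* Defs.v *)
From HB Require Import structures.
From mathcomp Require Import all_boot all_order all_algebra all_fingroup.
From mathcomp Require Import all_classical all_reals all_analysis.

Set Implicit Arguments.
Unset Strict Implicit.
Unset Printing Implicit Defensive.

Import Order.TTheory GRing.Theory Num.Theory.
Import numFieldNormedType.Exports.

Local Open Scope classical_set_scope.
Local Open Scope ring_scope.

HB.instance Definition _ (n : nat) := isPointed.Build 'I_n.+1 ord0.

HB.instance Definition _ (n : nat) :=
  @isMeasurable.Build default_measure_display 'I_n.+1
    discrete_measurable discrete_measurable0
    discrete_measurableC discrete_measurableU.

(* The right edge of the atomic square c is glued to the left edge of the
   square [right_square P c], and its top edge to the bottom edge of
   [upper_square P c].  There are [nsquares_pred P].+1 atomic squares. *)
Record polysquare := Polysquare {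
  nsquares_pred : nat ;
  right_square : {perm 'I_nsquares_pred.+1} ;
  upper_square : {perm 'I_nsquares_pred.+1} ;
  polysquare_connected :
    forall c c' : 'I_nsquares_pred.+1,
      connect [rel i j | [|| j == right_square i, i == right_square j,
                       j == upper_square i | i == upper_square j]] c c'
}.

Notation square P := 'I_(nsquares_pred P).+1.

(* One counterclockwise turn, starting from c, around the lower left vertex
   of c: across the left, the bottom, the right and the top edge.  Permutations
   compose from left to right. *)
Definition turn (P : polysquare) : {perm (square P)} :=
  ((right_square P)^-1 * (upper_square P)^-1 *
   right_square P * upper_square P)%g.

(* Each square in the orbit of c under [turn] contributes four right angles. *)
Definition cone_angle (R : realType) (P : polysquare) (c : square P) : R :=
  2 * pi * #|porbit (turn P) c|%:R.

(* (c, x, y) with 0 <= x, y < 1 is the point with coordinates (x, y) in the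
   square c: the top and right edges of a square belong to its neighbours.
   Every point of the surface is represented exactly once, except that a
   vertex of cone angle 2 k pi is represented by the k squares of which it is
   the lower left corner; this only affects singularities.  Triples with
   coordinates outside of [0, 1) are not points of the surface. *)
Definition surface_point (R : realType) (P : polysquare) : Type :=
  (square P * R * R)%type.

Definition singular (R : realType) (P : polysquare) (p : surface_point R P) :
    Prop :=
  let: (c, x, y) := p in
  [/\ x = 0, y = 0 & cone_angle R c <> 2 * pi].

Definition frac (R : realType) (x : R) : R := x - (Num.floor x)%:~R.

Definition cross (n : nat) (s : {perm 'I_n}) (R : realType) (x : R)
    (c : 'I_n) : 'I_n :=
  if x < 0 then (s^-1)%g c else if x < 1 then c else s c.

(* The point p + a, for a so small that at most one edge of each direction is
   crossed.  At a vertex that is not singular, the two orders of crossing lead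
   to the same square. *)
Definition displace (R : realType) (P : polysquare) (p : surface_point R P)
    (a : R * R) : surface_point R P :=
  let: (c, x, y) := p in
  (cross (upper_square P) (y + a.2) (cross (right_square P) (x + a.1) c),
   frac (x + a.1), frac (y + a.2)).

(* Straight line motion with constant velocity u during the time interval
   [0, L], avoiding the singularities.  Taking s = t shows that g t has both
   coordinates in [0, 1). *)
Definition geodesic (R : realType) (P : polysquare) (u : R * R) (L : R)
    (g : R -> surface_point R P) : Prop :=
  forall t, 0 <= t <= L ->
    ~ singular (g t) /\
    \forall s \near t, 0 <= s <= L ->
      g s = displace (g t) ((s - t) * u.1, (s - t) * u.2).

Definition euclidean_norm (R : realType) (v : R * R) : R :=
  Num.sqrt (v.1 ^+ 2 + v.2 ^+ 2).

Definition shift_rel (R : realType) (P : polysquare) (v : R * R)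
    (p q : surface_point R P) : Prop :=
  let L := euclidean_norm v in
  exists g : R -> surface_point R P,
    [/\ geodesic (v.1 / L, v.2 / L) L g, g 0 = p & g L = q].

(* [shift_rel v] is a partial function, defined almost everywhere; it is made
   total by fixing the points where it is undefined. *)
Definition surface_shift (R : realType) (P : polysquare) (v : R * R)
    (p : surface_point R P) : surface_point R P :=
  xget p [set q : square P * R * R | shift_rel v p q].

Definition manifold_shift (R : realType) (P : polysquare) (v : R * R) (w : R)
    (p : surface_point R P * R) : surface_point R P * R :=
  (surface_shift v p.1, frac (p.2 + w)).

Definition unit_squares (R : realType) (P : polysquare) :
    set (square P * measurableTypeR R * measurableTypeR R) :=
  [set: square P] `*` `[0, 1[ `*` `[0, 1[.
Arguments unit_squares : clear implicits.

Lemma measurable_unit_squares (R : realType) (P : polysquare) :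
  measurable (unit_squares R P).
Proof. by do 2![apply: measurableX => //]; exact: measurable_itv. Qed.

Definition unit_cubes (R : realType) (P : polysquare) :
    set (square P * measurableTypeR R * measurableTypeR R *
         measurableTypeR R) :=
  unit_squares R P `*` `[0, 1[.
Arguments unit_cubes : clear implicits.

Lemma measurable_unit_cubes (R : realType) (P : polysquare) :
  measurable (unit_cubes R P).
Proof.
by apply: measurableX; [exact: measurable_unit_squares|exact: measurable_itv].
Qed.

Definition area (R : realType) (P : polysquare) :
    {measure set (square P * measurableTypeR R * measurableTypeR R) ->
       \bar R} :=
  mrestr (@counting (square P) R \x @lebesgue_measure R
          \x @lebesgue_measure R)%E
         (@measurable_unit_squares R P).
Arguments area : clear implicits.

Definition volume (R : realType) (P : polysquare) :
    {measure set (square P * measurableTypeR R * measurableTypeR R *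
                  measurableTypeR R) -> \bar R} :=
  mrestr (@counting (square P) R \x @lebesgue_measure R
          \x @lebesgue_measure R \x @lebesgue_measure R)%E
         (@measurable_unit_cubes R P).
Arguments volume : clear implicits.

(* An ergodic map is in particular measure preserving.  As the maps of interest
   are only defined up to null sets, so is the invariance of a set. *)
Definition ergodic (d : measure_display) (X : measurableType d) (R : realType)
    (mu : {measure set X -> \bar R}) (f : X -> X) : Prop :=
  [/\ measurable_fun [set: X] f,
      forall A : set X, measurable A -> mu (f @^-1` A) = mu A &
      forall A : set X, measurable A ->
        {ae mu, forall x, A (f x) <-> A x} ->
        mu A = 0%E \/ mu (~` A) = 0%E].

Definition rat_independent (R : realType) (n : nat) (x : n.-tuple R) : Prop :=
  forall q : 'I_n -> rat,
    \sum_(i < n) ratr (q i) * tnth x i = 0 -> forall i, q i = 0.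

(* Main.v *)
Require Import Defs.
From HB Require Import structures.
From mathcomp Require Import all_boot all_order all_algebra all_fingroup.
From mathcomp Require Import all_classical all_reals all_analysis.
From mathcomp Require Import measurable_realfun.
From mathcomp Require Import complex ring lra.

(** The shift of the manifold is the skew product [(x, z) |-> (S x, z + w)] of
the shift [S] of the surface and a rotation of the circle. Its ergodicity thus
depends on the eigenvalues of [S]; below, [e] denotes [expi2pi].

Let [S] be ergodic and let [A] be a set invariant under the skew product. The
[k]-th Fourier coefficient [a] of the fibre of [A] over [x], as a function of
[x], satisfies [a (S x) = e (k * w) * a x] ([ergodic_skew_rotation]). It
vanishes for [k != 0]. Indeed [S] moves the coordinates of a point inside its
square by the translation of the torus by [v] ([ae_shift_coordinates]), so
[a ^+ j] times the character of index [(k1, k2)] of these coordinates is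
multiplied by [e (j * k * w + k1 * v1 + k2 * v2)] under [S]; this is not [1] for
[0 < j], because [v1], [v2], [w] and [1] are independent over the rationals. As
[S] preserves the measure, the integral of this function is zero. Hence the sum
of [a ^+ j] over the points with the same coordinates in all the squares is a
function on the torus without Fourier coefficients. By uniqueness of Fourier
coefficients ([Fourier_uniqueness]) it is zero for every [0 < j], and numbers
whose power sums all vanish are zero ([power_sums_eq0], [eigenfunction_eq0]).
Using uniqueness once more, almost every fibre of [A] is null or of full
measure, and the ergodicity of [S] decides between the two.

Uniqueness of Fourier coefficients is proved by approximation: polynomials in a
cosine are trigonometric polynomials, and suitable ones are bounded and tend to
the indicators of arcs, so a function without Fourier coefficients has integral
zero on every interval.

The geometry of the surface enters only through the fact that the coordinates
along a geodesic move with constant velocity modulo 1. That almost every point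
has a geodesic in the first place also follows from the ergodicity of [S], which
fixes the other points: an ergodic map of a measure without atoms cannot fix a
set of positive measure ([ae_not_fixed]).

Conversely, [S] is a factor of the skew product, whatever [w] is
([ergodic_base]), and some [w] is independent of [v1], [v2] and [1] because the
rational combinations of these are countably many. *)

Set Implicit Arguments.
Unset Strict Implicit.
Unset Printing Implicit Defensive.
Import Order.TTheory GRing.Theory Num.Theory.
Import numFieldNormedType.Exports.
Local Open Scope classical_set_scope.
Local Open Scope ring_scope.
Local Open Scope complex_scope.
Local Notation frac := Defs.frac.

(** * Bounded measurable functions and finite measures *)

(** Bounded measurable functions are closed under the operations below and are
integrable for every finite measure, so that integrability never has to be
checked separately. *)
Definition bmeas d (T : measurableType d) (R : realType) (f : T -> R) : Prop :=
  measurable_fun [set: T] f /\ exists M, forall x, `|f x| <= M.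

Section bmeas.
Context d (T : measurableType d) (R : realType).
Implicit Types f g : T -> R.

Lemma bmeas_cst (r : R) : bmeas (fun _ : T => r).
Proof. by split=> //; exists `|r|. Qed.

Lemma bmeasD f g : bmeas f -> bmeas g -> bmeas (fun x => f x + g x).
Proof.
move=> [mf [M fM]] [mg [N gN]]; split; first exact: measurable_funD.
by exists (M + N) => x; rewrite (le_trans (ler_normD _ _))// lerD.
Qed.

Lemma bmeasN f : bmeas f -> bmeas (fun x => - f x).
Proof.
move=> [mf [M fM]]; split; first exact: measurableT_comp.
by exists M => x; rewrite normrN.
Qed.

Lemma bmeasB f g : bmeas f -> bmeas g -> bmeas (fun x => f x - g x).
Proof. by move=> bf bg; apply: bmeasD => //; exact: bmeasN. Qed.

Lemma bmeasM f g : bmeas f -> bmeas g -> bmeas (fun x => f x * g x).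
Proof.
move=> [mf [M fM]] [mg [N gN]]; split; first exact: measurable_funM.
by exists (M * N) => x; rewrite normrM ler_pM.
Qed.

Lemma bmeasX f n : bmeas f -> bmeas (fun x => f x ^+ n).
Proof.
move=> bf; elim: n => [|n ih]; first exact: bmeas_cst.
by rewrite (_ : (fun x => _) = fun x => f x * f x ^+ n);
  [exact: bmeasM|by apply/funext => x; rewrite exprS].
Qed.

Lemma bmeas_indic (A : set T) : measurable A -> bmeas (\1_A : T -> R).
Proof.
move=> mA; split; first exact: measurable_indic.
by exists 1 => x; rewrite indicE; case: (_ \in _); rewrite ?normr1 ?normr0.
Qed.

Lemma bmeas_integrable (mu : {measure set T -> \bar R}) f :
  (mu setT < +oo)%E -> bmeas f -> mu.-integrable [set: T] (EFin \o f).
Proof.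
move=> muT [mf [M fM]]; apply: measurable_bounded_integrable => //.
exists M; split; first exact: num_real.
by move=> N MN x _; exact: le_trans (fM x) (ltW MN).
Qed.

End bmeas.

Lemma bmeas_comp d d' (T : measurableType d) (T' : measurableType d')
    (R : realType) (f : T' -> R) (phi : T -> T') :
  measurable_fun setT phi -> bmeas f -> bmeas (fun x => f (phi x)).
Proof.
move=> mphi [mf [M fM]]; split; first exact: measurableT_comp.
by exists M.
Qed.

Lemma finite_measure_lty d (T : measurableType d) (R : realType)
    (m : {finite_measure set T -> \bar R}) A : measurable A -> (m A < +oo)%E.
Proof. by move=> mA; rewrite -ge0_fin_numE//; exact: fin_num_measure. Qed.

Lemma normr_Rintegral_le d (T : measurableType d) (R : realType)
    (mu : {finite_measure set T -> \bar R}) (g : T -> R) M :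
  bmeas g -> (forall x, `|g x| <= M) -> `|\int[mu]_x g x| <= M * fine (mu setT).
Proof.
move=> bg gM.
have ig := bmeas_integrable (finite_measure_lty mu measurableT) bg.
apply: le_trans (le_normr_Rintegral _ ig) _ => //.
rewrite -Rintegral_cst//; apply: le_Rintegral => //.
- apply: bmeas_integrable; first exact: finite_measure_lty.
  case: bg => mg [N gN]; split; first exact: measurableT_comp.
  by exists N => x; rewrite normr_id.
- by apply: bmeas_integrable; [exact: finite_measure_lty|exact: bmeas_cst].
Qed.

Section product_finite.
Context d1 d2 (T1 : measurableType d1) (T2 : measurableType d2) (R : realType).
Variables (m1 : {finite_measure set T1 -> \bar R})
  (m2 : {finite_measure set T2 -> \bar R}).

(** The product has a name of its own in order to carry the structure of a
finite measure, which its use as a factor of a further product requires. *)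
Definition finite_prod : set (T1 * T2) -> \bar R := (m1 \x m2)%E.

HB.instance Definition _ := Measure.on finite_prod.

Lemma finite_prodE (A : set T1) (B : set T2) :
  measurable A -> measurable B -> finite_prod (A `*` B) = (m1 A * m2 B)%E.
Proof. exact: product_measure1E. Qed.

Let finite_prod_finite : fin_num_fun finite_prod.
Proof.
move=> A mA; rewrite ge0_fin_numE//.
apply: (@le_lt_trans _ _ (finite_prod setT)).
  by apply: le_measure => //; rewrite inE.
rewrite -setXTT finite_prodE//.
apply: lte_mul_pinfty => //; first exact: fin_num_measure.
exact: finite_measure_lty.
Qed.

HB.instance Definition _ := Measure_isFinite.Build _ _ _ finite_prod
  finite_prod_finite.

End product_finite.

Section Fubini_bmeas.
Context d1 d2 (T1 : measurableType d1) (T2 : measurableType d2) (R : realType).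
Variables (m1 : {finite_measure set T1 -> \bar R})
  (m2 : {finite_measure set T2 -> \bar R}).
Variable f : T1 * T2 -> R.
Hypothesis bf : bmeas f.

Let mfT : (finite_prod m1 m2 setT < +oo)%E.
Proof. by apply: finite_measure_lty. Qed.

Lemma bmeas_section1 x : bmeas (fun y => f (x, y)).
Proof. by apply: bmeas_comp bf; exact: pair1_measurable. Qed.

Lemma bmeas_section2 y : bmeas (fun x => f (x, y)).
Proof. by apply: bmeas_comp bf; exact: pair2_measurable. Qed.

Let EFin_Rintegral1 x :
  ((\int[m2]_y f (x, y))%R)%:E = (\int[m2]_y (f (x, y))%:E)%E.
Proof.
rewrite fineK//; apply: integrable_fin_num => //.
by apply: bmeas_integrable; [exact: finite_measure_lty|exact: bmeas_section1].
Qed.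

Let EFin_Rintegral2 y :
  ((\int[m1]_x f (x, y))%R)%:E = (\int[m1]_x (f (x, y))%:E)%E.
Proof.
rewrite fineK//; apply: integrable_fin_num => //.
by apply: bmeas_integrable; [exact: finite_measure_lty|exact: bmeas_section2].
Qed.

Lemma bmeas_Rintegral1 : bmeas (fun x => \int[m2]_y f (x, y)).
Proof.
split; last first.
  case: (bf) => _ [M fM]; exists (M * fine (m2 setT)) => x.
  by apply: normr_Rintegral_le => //; exact: bmeas_section1.
apply: (measurableT_comp (fine_measurable measurableT)).
exact: (measurable_fubini_F (bmeas_integrable mfT bf)).
Qed.

Lemma bmeas_Rintegral2 : bmeas (fun y => \int[m1]_x f (x, y)).
Proof.
split; last first.
  case: (bf) => _ [M fM]; exists (M * fine (m1 setT)) => x.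
  by apply: normr_Rintegral_le => //; exact: bmeas_section2.
apply: (measurableT_comp (fine_measurable measurableT)).
exact: (measurable_fubini_G (bmeas_integrable mfT bf)).
Qed.

Lemma Rintegral_prod1 :
  \int[finite_prod m1 m2]_z f z = \int[m1]_x \int[m2]_y f (x, y).
Proof.
rewrite /Rintegral -(integral12_prod_meas1 (bmeas_integrable mfT bf)).
by congr fine; apply: eq_integral => x _; rewrite EFin_Rintegral1.
Qed.

Lemma Rintegral_prod2 :
  \int[finite_prod m1 m2]_z f z = \int[m2]_y \int[m1]_x f (x, y).
Proof.
rewrite /Rintegral -(integral21_prod_meas1 (bmeas_integrable mfT bf)).
by congr fine; apply: eq_integral => x _; rewrite EFin_Rintegral2.
Qed.

End Fubini_bmeas.

Section integration.
Context d (T : measurableType d) (R : realType)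
  (mu : {finite_measure set T -> \bar R}).

Lemma bmeas_finite_integrable (f : T -> R) :
  bmeas f -> mu.-integrable [set: T] (EFin \o f).
Proof. by apply: bmeas_integrable; exact: finite_measure_lty. Qed.

Lemma ae_eq_Rintegral (f g : T -> R) : bmeas f -> bmeas g ->
  {ae mu, forall x, f x = g x} -> \int[mu]_x f x = \int[mu]_x g x.
Proof.
move=> [mf _] [mg _] fg; congr fine; apply: ae_eq_integral => //.
- exact/measurable_EFinP.
- exact/measurable_EFinP.
- by apply: filterS fg => x fgx _; rewrite /= fgx.
Qed.

Lemma Rintegral_measure_preserving (S : T -> T) (f : T -> R) :
  measurable_fun setT S ->
  (forall A, measurable A -> mu (S @^-1` A) = mu A) -> bmeas f ->
  \int[mu]_x f (S x) = \int[mu]_x f x.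
Proof.
move=> mS muS bf; congr fine.
have bfS := bmeas_comp mS bf.
transitivity (\int[pushforward mu S]_y (f y)%:E)%E; last first.
  by apply: eq_measure_integral => A mA _; exact: muS.
rewrite integral_pushforward//.
- by case: bf => mf _; exact/measurable_EFinP.
- exact: bmeas_finite_integrable.
Qed.

Lemma Rintegral_eq0_ae (f : T -> R) : bmeas f -> (forall x, 0 <= f x) ->
  \int[mu]_x f x = 0 -> {ae mu, forall x, f x = 0}.
Proof.
move=> bf f0 intf.
have : (\int[mu]_x (f x)%:E = 0)%E.
  rewrite -[LHS]fineK ?[X in X%:E]intf//.
  by apply: integrable_fin_num => //; exact: bmeas_finite_integrable.
rewrite -[X in X = _](@eq_integral _ _ _ _ _ _ (fun x => `|(f x)%:E|)%E);
  last first.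
  by move=> x _; rewrite gee0_abs// lee_fin.
case: bf => /measurable_EFinP mf _.
move/(ae_eq_integral_abs mu measurableT mf).
by apply: filterS => x /(_ I) /= [].
Qed.

End integration.

(** * Almost everywhere statements on products *)

Lemma Rintegral_indic d (T : measurableType d) (R : realType)
    (m : {finite_measure set T -> \bar R}) (N : set T) : measurable N ->
  \int[m]_x (\1_N x : R) = fine (m N).
Proof. by move=> mN; rewrite /Rintegral integral_indic// setIT. Qed.

Lemma Rintegral_eq0_negligible d (T : measurableType d) (R : realType)
    (m : {finite_measure set T -> \bar R}) (N : set T) : measurable N ->
  \int[m]_x \1_N x = 0 -> m N = 0%E.
Proof.
move=> mN; rewrite Rintegral_indic// => h.
by rewrite -[LHS]fineK ?h//; exact: fin_num_measure.
Qed.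

Section ae_Fubini.
Context d1 d2 (T1 : measurableType d1) (T2 : measurableType d2) (R : realType)
  (m1 : {finite_measure set T1 -> \bar R})
  (m2 : {finite_measure set T2 -> \bar R}).

Lemma ae_prod1 (Q : T1 * T2 -> Prop) :
  {ae finite_prod m1 m2, forall p, Q p} ->
  {ae m1, forall x, {ae m2, forall y, Q (x, y)}}.
Proof.
move=> [N [mN N0 QN]].
have bN := bmeas_indic R mN.
have : {ae m1, forall x, \int[m2]_y \1_N (x, y) = 0 :> R}.
  apply: Rintegral_eq0_ae.
  - exact: (bmeas_Rintegral1 m1 m2 bN).
  - by move=> x; apply: Rintegral_ge0 => y _.
  - by rewrite -Rintegral_prod1// Rintegral_indic// [X in fine X]N0.
apply: filterS => x Nx0.
have : {ae m2, forall y, \1_N (x, y) = 0 :> R}.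
  by apply: Rintegral_eq0_ae Nx0 => //; exact: (bmeas_section1 bN).
apply: filterS => y; rewrite indicE => Nxy; apply: contrapT => nQ.
move: Nxy; rewrite mem_set; last exact: QN.
by move/eqP; rewrite oner_eq0.
Qed.

Lemma negligible_prod1 (N : set (T1 * T2)) : measurable N ->
  {ae m1, forall x, {ae m2, forall y, ~ N (x, y)}} -> finite_prod m1 m2 N = 0%E.
Proof.
move=> mN N0; have bN := bmeas_indic R mN.
apply: Rintegral_eq0_negligible => //; rewrite Rintegral_prod1//.
transitivity (\int[m1]_x (fun=> 0) x : R);
  last by rewrite Rintegral_cst// mul0r.
apply: ae_eq_Rintegral; [exact: (bmeas_Rintegral1 m1 m2 bN)|exact: bmeas_cst|].
apply: filterS N0 => x Nx.
transitivity (\int[m2]_x (fun=> 0) x : R);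
  last by rewrite Rintegral_cst// mul0r.
apply: ae_eq_Rintegral; [exact: (bmeas_section1 bN)|exact: bmeas_cst|].
by apply: filterS Nx => y Nxy; rewrite indicE memNset.
Qed.

Lemma negligible_prod2 (N : set (T1 * T2)) : measurable N ->
  {ae m2, forall y, {ae m1, forall x, ~ N (x, y)}} -> finite_prod m1 m2 N = 0%E.
Proof.
move=> mN N0; have bN := bmeas_indic R mN.
apply: Rintegral_eq0_negligible => //; rewrite Rintegral_prod2//.
transitivity (\int[m2]_x (fun=> 0) x : R);
  last by rewrite Rintegral_cst// mul0r.
apply: ae_eq_Rintegral; [exact: (bmeas_Rintegral2 m1 m2 bN)|exact: bmeas_cst|].
apply: filterS N0 => y Ny.
transitivity (\int[m1]_x (fun=> 0) x : R);
  last by rewrite Rintegral_cst// mul0r.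
apply: ae_eq_Rintegral; [exact: (bmeas_section2 bN)|exact: bmeas_cst|].
by apply: filterS Ny => x Nxy; rewrite indicE memNset.
Qed.

End ae_Fubini.

Lemma ae_forall_count d (T : measurableType d) (R : realType)
    (m : {measure set T -> \bar R}) (I : countType) (Q : I -> T -> Prop) :
  (forall i, {ae m, forall x, Q i x}) -> {ae m, forall x, forall i, Q i x}.
Proof.
move=> h; pose Q' n x := if unpickle n is Some i then Q i x else True.
have : {ae m, forall x, forall n, Q' n x}.
  apply: ae_foralln => n; rewrite /Q'; case: unpickle => [i|]; first exact: h.
  exact: filterT.
by apply: filterS => x h' i; have := h' (pickle i); rewrite /Q' pickleK.
Qed.

(** * Integrals of complex functions *)

Section complex_valued.
Context (R : realType).

Definition cbmeas d (T : measurableType d) (f : T -> R[i]) : Prop :=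
  bmeas (fun x => complex.Re (f x)) /\ bmeas (fun x => complex.Im (f x)).

Section cbmeas.
Context d (T : measurableType d).
Implicit Types f g : T -> R[i].

Lemma cbmeas_cst (c : R[i]) : cbmeas (fun _ : T => c).
Proof. by split; exact: bmeas_cst. Qed.

Lemma cbmeas_real (f : T -> R) : bmeas f -> cbmeas (fun x => (f x)%:C).
Proof. by move=> bf; split => //; exact: bmeas_cst. Qed.

Lemma complex_ReD (z w : R[i]) :
  complex.Re (z + w) = complex.Re z + complex.Re w.
Proof. by case: z; case: w. Qed.

Lemma complex_ImD (z w : R[i]) :
  complex.Im (z + w) = complex.Im z + complex.Im w.
Proof. by case: z; case: w. Qed.

Lemma complex_ReM (z w : R[i]) : complex.Re (z * w) =
  complex.Re z * complex.Re w - complex.Im z * complex.Im w.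
Proof. by case: z; case: w. Qed.

Lemma complex_ImM (z w : R[i]) : complex.Im (z * w) =
  complex.Re z * complex.Im w + complex.Im z * complex.Re w.
Proof. by case: z; case: w. Qed.

Lemma cbmeasD f g : cbmeas f -> cbmeas g -> cbmeas (fun x => f x + g x).
Proof.
move=> [rf jf] [rg jg]; split.
- by under eq_fun do rewrite complex_ReD; exact: bmeasD.
- by under eq_fun do rewrite complex_ImD; exact: bmeasD.
Qed.

Lemma cbmeasM f g : cbmeas f -> cbmeas g -> cbmeas (fun x => f x * g x).
Proof.
move=> [rf jf] [rg jg]; split.
- under eq_fun do rewrite complex_ReM.
  by apply: bmeasB; exact: bmeasM.
- under eq_fun do rewrite complex_ImM.
  by apply: bmeasD; exact: bmeasM.
Qed.

Lemma cbmeasX f n : cbmeas f -> cbmeas (fun x => f x ^+ n).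
Proof.
move=> bf; elim: n => [|n ih]; first exact: cbmeas_cst.
by under eq_fun do rewrite exprS; exact: cbmeasM.
Qed.

End cbmeas.

Lemma cbmeas_comp d d' (T : measurableType d) (T' : measurableType d')
    (f : T' -> R[i]) (phi : T -> T') :
  measurable_fun setT phi -> cbmeas f -> cbmeas (fun x => f (phi x)).
Proof.
by move=> mphi [rf jf]; split; [exact: bmeas_comp rf|exact: bmeas_comp jf].
Qed.

Definition cint d (T : measurableType d) (mu : {measure set T -> \bar R})
    (f : T -> R[i]) : R[i] :=
  (\int[mu]_x complex.Re (f x)) +i* (\int[mu]_x complex.Im (f x)).

Section cint.
Context d (T : measurableType d) (mu : {finite_measure set T -> \bar R}).
Implicit Types f g : T -> R[i].

Lemma cintD f g : cbmeas f -> cbmeas g ->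
  cint mu (fun x => f x + g x) = cint mu f + cint mu g.
Proof.
move=> [rf jf] [rg jg]; rewrite /cint; simpc; congr (_ +i* _).
- under eq_Rintegral do rewrite complex_ReD.
  by rewrite RintegralD//; exact: bmeas_finite_integrable.
- under eq_Rintegral do rewrite complex_ImD.
  by rewrite RintegralD//; exact: bmeas_finite_integrable.
Qed.

Lemma cintZ (c : R[i]) f : cbmeas f ->
  cint mu (fun x => c * f x) = c * cint mu f.
Proof.
move=> [rf jf]; rewrite /cint; case: c => a b; simpc; congr (_ +i* _).
- under eq_Rintegral do rewrite complex_ReM/=.
  rewrite RintegralB//; [|exact/bmeas_finite_integrable/bmeasM/rf/bmeas_cst
                         |exact/bmeas_finite_integrable/bmeasM/jf/bmeas_cst].
  by rewrite !RintegralZl//; exact: bmeas_finite_integrable.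
- under eq_Rintegral do rewrite complex_ImM/=.
  rewrite RintegralD//; [|exact/bmeas_finite_integrable/bmeasM/jf/bmeas_cst
                         |exact/bmeas_finite_integrable/bmeasM/rf/bmeas_cst].
  by rewrite !RintegralZl//; exact: bmeas_finite_integrable.
Qed.

Lemma ae_eq_cint f g : cbmeas f -> cbmeas g ->
  {ae mu, forall x, f x = g x} -> cint mu f = cint mu g.
Proof.
move=> [rf jf] [rg jg] fg; congr (_ +i* _); apply: ae_eq_Rintegral => //.
- by apply: filterS fg => x ->.
- by apply: filterS fg => x ->.
Qed.

Lemma cint_measure_preserving (S : T -> T) f :
  measurable_fun setT S ->
  (forall A, measurable A -> mu (S @^-1` A) = mu A) -> cbmeas f ->
  cint mu (fun x => f (S x)) = cint mu f.
Proof.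
move=> mS muS [rf jf].
by congr (_ +i* _);
  [exact: (Rintegral_measure_preserving mS muS rf)
  |exact: (Rintegral_measure_preserving mS muS jf)].
Qed.

End cint.

Section cint_Fubini.
Context d1 d2 (T1 : measurableType d1) (T2 : measurableType d2)
  (m1 : {finite_measure set T1 -> \bar R})
  (m2 : {finite_measure set T2 -> \bar R}) (f : T1 * T2 -> R[i]).
Hypothesis bf : cbmeas f.

Lemma cbmeas_section1 x : cbmeas (fun y => f (x, y)).
Proof. by apply: cbmeas_comp bf; exact: pair1_measurable. Qed.

Lemma cbmeas_section2 y : cbmeas (fun x => f (x, y)).
Proof. by apply: cbmeas_comp bf; exact: pair2_measurable. Qed.

Lemma cbmeas_cint1 : cbmeas (fun x => cint m2 (fun y => f (x, y))).
Proof.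
by case: bf => rf jf; split;
  [exact: (bmeas_Rintegral1 m1 m2 rf)|exact: (bmeas_Rintegral1 m1 m2 jf)].
Qed.

Lemma cbmeas_cint2 : cbmeas (fun y => cint m1 (fun x => f (x, y))).
Proof.
by case: bf => rf jf; split;
  [exact: (bmeas_Rintegral2 m1 m2 rf)|exact: (bmeas_Rintegral2 m1 m2 jf)].
Qed.

Lemma cint_prod2 :
  cint (finite_prod m1 m2) f = cint m2 (fun y => cint m1 (fun x => f (x, y))).
Proof. by case: bf => rf jf; rewrite /cint/= !Rintegral_prod2. Qed.

End cint_Fubini.

End complex_valued.

(** * Counting measure and the circle *)

Section finite_counting.
Context (R : realType) (n : nat).

(** The counting measure under a name that carries its finiteness. *)
Definition card_measure : set 'I_n.+1 -> \bar R := @counting 'I_n.+1 R.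

HB.instance Definition _ := Measure.on card_measure.

Let card_measure_finite : fin_num_fun card_measure.
Proof.
move=> A _; rewrite /card_measure /counting asboolT//.
exact: finite_finset.
Qed.

HB.instance Definition _ := Measure_isFinite.Build _ _ _ card_measure
  card_measure_finite.

Lemma card_measure1 i : card_measure [set i] = 1%E.
Proof.
by rewrite /card_measure /counting asboolT// fset_set1 finmap.cardfs1.
Qed.

Lemma bmeas_ord (f : 'I_n.+1 -> R) : bmeas f.
Proof.
split; first by move=> _ B _; exact: I.
exists (\sum_i `|f i|) => i; rewrite (bigD1 i)//= lerDl.
by apply: sumr_ge0.
Qed.

Lemma Rintegral_card (f : 'I_n.+1 -> R) :
  \int[card_measure]_i f i = \sum_i f i.
Proof.
have int_sum (s : seq 'I_n.+1) :
    \int[card_measure]_i (\sum_(j <- s) f j * \1_[set j] i) = \sum_(j <- s) f j.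
  elim: s => [|j s ih].
    under eq_Rintegral do rewrite big_nil.
    by rewrite Rintegral_cst// mul0r big_nil.
  under eq_Rintegral do rewrite big_cons.
  rewrite RintegralD//; try exact/bmeas_finite_integrable/bmeas_ord.
  rewrite ih big_cons RintegralZl//;
    last exact/bmeas_finite_integrable/bmeas_ord.
  congr (_ + _); rewrite /Rintegral integral_indic// setIT.
  by rewrite [X in fine X](card_measure1 j)/= mulr1.
rewrite -int_sum; apply: eq_Rintegral => i _.
rewrite (bigD1 i)//= indicE mem_set// mulr1 big1 ?addr0// => j ji.
by rewrite indicE memNset ?mulr0//= => /esym/eqP; rewrite (negbTE ji).
Qed.

Lemma cint_card (f : 'I_n.+1 -> R[i]) : cint card_measure f = \sum_i f i.
Proof.
rewrite /cint !Rintegral_card.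
apply: (big_ind3 (fun a b z => a +i* b = z)) => //.
  by move=> a b z a' b' z' <- <-; simpc.
by move=> i _; case: (f i).
Qed.

End finite_counting.

Section unit_interval.
Context (R : realType).

Let mI : measurable (`[0, 1[%classic : set (measurableTypeR R)).
Proof. exact: measurable_itv. Qed.

(** Lebesgue measure on the circle [R/Z], seen as a measure on the line that is
concentrated on the fundamental domain of [frac]. *)
Definition circle_measure : set (measurableTypeR R) -> \bar R :=
  mrestr lebesgue_measure mI.

HB.instance Definition _ := Measure.on circle_measure.

Lemma circle_measureE A : circle_measure A = lebesgue_measure (A `&` `[0, 1[).
Proof. by []. Qed.

Lemma circle_measureT : circle_measure setT = 1%E.
Proof. by rewrite circle_measureE setTI lebesgue_measure_itv/= lte01 sube0. Qed.

Let circle_measure_finite : fin_num_fun circle_measure.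
Proof.
move=> A mA; rewrite ge0_fin_numE//.
apply: (@le_lt_trans _ _ (circle_measure setT)).
  by apply: le_measure => //; rewrite inE.
by rewrite circle_measureT ltry.
Qed.

HB.instance Definition _ := Measure_isFinite.Build _ _ _ circle_measure
  circle_measure_finite.

Lemma ae_circle : {ae circle_measure, forall t, 0 <= t < 1}.
Proof.
exists (~` `[0, 1[%classic); split; first exact: measurableC.
  by rewrite circle_measureE setICl measure0.
by apply: subsetC => t /=; rewrite in_itv.
Qed.

End unit_interval.

Section frac.
Context (R : realType).
Implicit Types t x : R.

Lemma frac_itv t : 0 <= frac t < 1.
Proof.
by rewrite subr_ge0 ltrBlDl -(intrD _ _ 1) floor_itv.
Qed.

Lemma frac_id t : 0 <= t < 1 -> frac t = t.
Proof.
by move=> t01; rewrite /Defs.frac (@floor_def _ t 0) ?subr0// add0r.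
Qed.

Lemma fracDz t (k : int) : frac (t + k%:~R) = frac t.
Proof. by rewrite /Defs.frac floorDrz ?intr_int// intrKfloor intrD; ring. Qed.

Lemma fracE t : exists k : int, frac t = t + k%:~R.
Proof. by exists (- Num.floor t); rewrite /Defs.frac intrN. Qed.

Lemma frac_fracD s t : frac (frac s + t) = frac (s + t).
Proof. by have [k ->] := fracE s; rewrite addrAC fracDz. Qed.

Lemma measurable_frac : measurable_fun setT (@Defs.frac R).
Proof.
apply: measurable_funB => //; apply: nondecreasing_measurable => // x y xy.
by rewrite ler_int; exact: le_floor.
Qed.

End frac.

Section circle_character.
Context (R : realType).
Implicit Types s t : R.

Definition expi2pi t : R[i] := cos (2 * pi * t) +i* sin (2 * pi * t).

Lemma expi2piD s t : expi2pi (s + t) = expi2pi s * expi2pi t.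
Proof.
rewrite /expi2pi mulrDr cosD sinD; simpc; congr (_ +i* _).
by rewrite addrC.
Qed.

Lemma expi2pi0 : expi2pi 0 = 1.
Proof. by rewrite /expi2pi mulr0 cos0 sin0. Qed.

Lemma expi2pi1 : expi2pi 1 = 1.
Proof. by rewrite /expi2pi mulr1 mulr_natl cos2pi sin2pi. Qed.

Lemma expi2pi_half : expi2pi 2^-1 = -1.
Proof.
rewrite /expi2pi mulrAC divff// mul1r cospi sinpi.
by apply/eqP; rewrite eq_complex /= oppr0 !eqxx.
Qed.

Lemma expi2piX t n : expi2pi t ^+ n = expi2pi (n%:R * t).
Proof.
elim: n => [|n ih]; first by rewrite mul0r expi2pi0.
by rewrite exprS ih -expi2piD -(natr1 n); congr expi2pi; ring.
Qed.

Lemma expi2pi_int (k : int) : expi2pi k%:~R = 1.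
Proof.
have nat n : expi2pi n%:R = 1 by rewrite -[n%:R]mulr1 -expi2piX expi2pi1 expr1n.
case: (intP k) => [|n|n]; first exact: nat 0%N.
  exact: nat.
by rewrite -[LHS]mulr1 -[X in _ * X](nat n.+1) -expi2piD intrN addNr expi2pi0.
Qed.

Lemma expi2piDz t (k : int) : expi2pi (t + k%:~R) = expi2pi t.
Proof. by rewrite expi2piD expi2pi_int mulr1. Qed.

Lemma expi2pi_frac t (k : int) : expi2pi (k%:~R * frac t) = expi2pi (k%:~R * t).
Proof. by rewrite /Defs.frac mulrBr -intrM -intrN expi2piDz. Qed.

Lemma sin_pi_gt0 t : 0 < t < 1 -> 0 < sin (pi * t).
Proof.
move=> /andP[t0 t1]; apply: sin_gt0_pi.
by rewrite mulr_gt0 ?pi_gt0//= -[ltRHS]mulr1 ltr_pM2l ?pi_gt0.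
Qed.

Lemma expi2pi_eq1 t : expi2pi t = 1 -> exists k : int, t = k%:~R.
Proof.
rewrite -[t in expi2pi t]mul1r -(expi2pi_frac t 1) mul1r.
have [f0 f1] := andP (frac_itv t) => /(congr1 (@complex.Re R)) /= cos1.
exists (Num.floor t); apply/eqP; rewrite -subr_eq0 -/(Defs.frac t).
apply: contraT => fn0.
have {fn0}f0 : 0 < frac t by rewrite lt_neqAle eq_sym fn0.
(* [cos (2 x) = 1 - 2 * sin x ^+ 2], so [sin (pi * frac t)] vanishes. *)
have : 0 < sin (pi * frac t) by rewrite sin_pi_gt0// f0.
have : sin (pi * frac t) ^+ 2 = 0.
  have := cos_mulr2n (pi * frac t).
  rewrite -mulrnAl mulrnAl -mulr_natl mulrA cos1 sin2cos2; lra.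
by move/eqP; rewrite sqrf_eq0 => /eqP ->; rewrite ltxx.
Qed.

Lemma cbmeas_expi2pi (a : R) :
  cbmeas (fun t : measurableTypeR R => expi2pi (a * t)).
Proof.
have ma : measurable_fun setT (fun t : R => 2 * pi * (a * t)).
  by do 2! apply: measurable_funM => //.
split; (split; last by exists 1 => x; rewrite ?cos_max ?sin_max).
- apply: (measurableT_comp _ ma); apply: continuous_measurable_fun.
  exact: continuous_cos.
- apply: (measurableT_comp _ ma); apply: continuous_measurable_fun.
  exact: continuous_sin.
Qed.

End circle_character.

Section rotation.
Context (R : realType).

Lemma lebesgue_measure_translate (a : R) (A : set (measurableTypeR R)) :
  measurable A ->
  lebesgue_measure ((fun x => x + a) @^-1` A) = lebesgue_measure A.
Proof.
have mD : measurable_fun setT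
    (fun x : measurableTypeR R => x + a : measurableTypeR R).
  exact: measurable_funD.
move=> mA.
apply: esym; have : forall X, ocitv X -> lebesgue_measure X =
    pushforward lebesgue_measure
      (fun x : measurableTypeR R => x + a : measurableTypeR R) X.
  move=> X [[x y] _ <-] /=; rewrite /pushforward.
rewrite (_ : _ @^-1` _ = `]x - a, y - a]%classic); last first.
    by apply/seteqP; split => t; rewrite /= !in_itv/= ltrBlDr lerBrDr.
  rewrite !lebesgue_measure_itv/= !lte_fin ltrD2r.
  by case: ifP => // _; rewrite -!EFinB; congr (_%:E); ring.
by move/lebesgue_measure_unique; exact.
Qed.

Lemma circle_measure_rotate (w : R) (A : set (measurableTypeR R)) :
  measurable A -> circle_measure ((fun t => frac (t + w)) @^-1` A) =
  circle_measure A.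
Proof.
move=> mA; have /andP[] := frac_itv w.
have : forall t, frac (t + w) = frac (t + frac w).
  by move=> t; rewrite ![t + _]addrC frac_fracD.
move: (frac w) => u fracDu u0 u1.
have mI : forall a b : R,
    measurable (`[a, b[%classic : set (measurableTypeR R)).
  by move=> a b; exact: measurable_itv.
have mT : forall (a : R) (B : set (measurableTypeR R)), measurable B ->
    measurable ((fun x : measurableTypeR R => x + a : measurableTypeR R) @^-1` B).
  move=> a B mB; rewrite -[X in measurable X]setTI.
  by apply: measurable_funD => //.
(* Modulo 1, the rotation moves the points below [1 - u] by [u] and the
   others by [u - 1]. *)
rewrite !circle_measureE.
have -> : (fun t => frac (t + w)) @^-1` A `&` `[0, 1[ =
    ((fun x => x + u) @^-1` (A `&` `[u, 1[)) `|`
    ((fun x => x + (u - 1)) @^-1` (A `&` `[0, u[)).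
  apply/seteqP; split => t /=; rewrite !in_itv/=.
  - rewrite fracDu => -[At /andP[t0 t1]]; have [tu|tu] := ltP (t + u) 1.
    + left; move: At.
      by rewrite frac_id ?tu ?addr_ge0// => At; split => //; lra.
    + right; move: At; have -> : t + u = t + (u - 1) + 1%:~R by ring.
      by rewrite fracDz frac_id; [move=> At; split => //|]; lra.
  - rewrite fracDu => -[[At tu]|[At tu]].
    + by rewrite frac_id; [split => //|]; lra.
    + have -> : t + u = t + (u - 1) + 1%:~R by ring.
      by rewrite fracDz frac_id; [split => //|]; lra.
have disj : (fun x => x + u) @^-1` (A `&` `[u, 1[) `&`
    (fun x => x + (u - 1)) @^-1` (A `&` `[0, u[) = set0.
  by apply/seteqP; split => // t /=; rewrite !in_itv/= => -[[_ h1] [_ h2]]; lra.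
rewrite measureU//; [|by apply: mT; exact: measurableI
                    |by apply: mT; exact: measurableI].
pose A1 := A `&` `[u, 1[; pose A2 := A `&` `[0, u[.
transitivity (lebesgue_measure A1 + lebesgue_measure A2)%E.
  by congr (_ + _)%E; apply: lebesgue_measure_translate; exact: measurableI.
rewrite -measureU; [|exact: measurableI|exact: measurableI|].
- congr lebesgue_measure.
  apply/seteqP; split => t; rewrite /A1 /A2 /= !in_itv/=.
  + by move=> [[At /andP[h1 h2]]|[At /andP[h1 h2]]]; split => //;
      apply/andP; split; lra.
  + move=> [At /andP[h1 h2]]; have [tu|tu] := ltP t u; [right|left];
      split => //; apply/andP; split; lra.
- apply/seteqP; split => // t; rewrite /A1 /A2 /= !in_itv/=.
  by move=> [[_ h1] [_ h2]]; lra.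
Qed.

Lemma cint_circle_rotate (w : R) (f : R -> R[i]) : cbmeas f ->
  cint (@circle_measure R) (fun t => f (frac (t + w))) =
  cint (@circle_measure R) f.
Proof.
move=> bf; apply: (cint_measure_preserving
  (S := fun t : measurableTypeR R => frac (t + w) : measurableTypeR R) _ _ bf).
  apply: (measurableT_comp (@measurable_frac R)).
  exact: measurable_funD.
by move=> A mA; exact: circle_measure_rotate.
Qed.

(** Rotating by half a period changes the sign of the character. *)
Lemma cint_expi2pi (k : int) : k != 0 ->
  cint (@circle_measure R) (fun t => expi2pi (k%:~R * t)) = 0.
Proof.
move=> k0; have k0' : k%:~R != 0 :> R by rewrite intr_eq0.
have := cint_circle_rotate ((2 * k%:~R)^-1) (@cbmeas_expi2pi R k%:~R).
have -> : (fun t => expi2pi (k%:~R * frac (t + (2 * k%:~R)^-1))) =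
    (fun t : R => -1 * expi2pi (k%:~R * t)).
  apply/funext => t; rewrite expi2pi_frac mulrDr expi2piD mulrC.
  by rewrite (_ : k%:~R * _ = 2^-1) ?expi2pi_half//; field.
rewrite cintZ; last exact: cbmeas_expi2pi.
move/eqP; rewrite mulN1r eq_sym -subr_eq0 opprK -mulr2n mulrn_eq0/=.
by move/eqP.
Qed.

End rotation.

(** * Uniqueness of Fourier coefficients *)

Section step_polynomials.
Context (R : realType).
Implicit Types x y : R.

Lemma bernoulli_ineq x n : -1 <= x -> 1 + n%:R * x <= (1 + x) ^+ n.
Proof.
move=> x1; elim: n => [|n ih]; first by rewrite mul0r addr0 expr0.
rewrite exprS; apply: (@le_trans _ _ ((1 + x) * (1 + n%:R * x))).
  have : 0 <= n%:R * x ^+ 2 :> R by rewrite mulr_ge0 ?sqr_ge0.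
  rewrite -(natr1 n).
  by rewrite expr2; lra.
by apply: ler_wpM2l => //; lra.
Qed.

(** On the unit interval these polynomials in [x] are bounded by [1] and tend to
[1] for [x < 1/2] and to [0] for [1/2 < x]: with [y = x ^+ n] and [m = 2 ^ n],
Bernoulli's inequality bounds [(1 - y) ^+ m] from below by [1 - (2 * x) ^+ n]
and, applied to [(1 + y) ^+ m], from above by [((2 * x) ^+ n)^-1]. *)
Definition step n x : R := (1 - x ^+ n) ^+ (2 ^ n).

Lemma step_itv n x : 0 <= x <= 1 -> 0 <= step n x <= 1.
Proof.
move=> /andP[x0 x1]; have := exprn_ge0 n x0; have := exprn_ile1 n x0 x1.
by move=> h1 h2; rewrite exprn_ge0 ?subr_ge0// exprn_ile1 ?subr_ge0// gerBl.
Qed.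

Lemma natrX2 n x : (2 ^ n)%:R * x ^+ n = (2 * x) ^+ n.
Proof. by rewrite natrX exprMn. Qed.

Lemma step_cvg1 x : 0 <= x < 2^-1 -> step n x @[n --> \oo] --> (1 : R).
Proof.
move=> /andP[x0 x2]; have xn n : 0 <= x ^+ n <= 1.
  by rewrite exprn_ge0//= exprn_ile1//; lra.
apply: (@squeeze_cvgr _ _ _ _ (fun n => 1 - (2 * x) ^+ n) (fun=> 1)).
- near=> n; have /andP[_ s1] : 0 <= step n x <= 1.
    by apply: step_itv; apply/andP; split; lra.
  apply/andP; split => //.
  have /andP[xn0 xn1] := xn n.
  rewrite -natrX2 -mulrN; apply: le_trans (bernoulli_ineq _ _) _ => //; lra.
- rewrite -[X in _ --> X]subr0; apply: cvgB; first exact: cvg_cst.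
  by apply: cvg_expr; rewrite ger0_norm; lra.
- exact: cvg_cst.
Unshelve. all: by end_near. Qed.

Lemma step_cvg0 x : 2^-1 < x <= 1 -> step n x @[n --> \oo] --> (0 : R).
Proof.
move=> /andP[x2 x1]; have xn n : 0 <= x ^+ n <= 1.
  by rewrite exprn_ge0 ?exprn_ile1//; lra.
apply: (@squeeze_cvgr _ _ _ _ (fun=> 0) (fun n => (2 * x)^-1 ^+ n)).
- near=> n; have /andP[xn0 xn1] := xn n.
  have /andP[s0 _] : 0 <= step n x <= 1.
    by apply: step_itv; apply/andP; split; lra.
  apply/andP; split => //.
  rewrite exprVn -[X in _ <= X]mul1r ler_pdivlMr;
    last by rewrite exprn_gt0//; lra.
  apply: (@le_trans _ _ ((1 - x ^+ n) ^+ (2 ^ n) * (1 + x ^+ n) ^+ (2 ^ n))).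
    apply: ler_wpM2l; first by rewrite exprn_ge0//; lra.
    rewrite -natrX2; apply: le_trans (bernoulli_ineq _ _); lra.
  rewrite -exprMn; apply: exprn_ile1.
    by apply: mulr_ge0; lra.
  by have := sqr_ge0 (x ^+ n); rewrite expr2; lra.
- exact: cvg_cst.
- apply: cvg_expr; rewrite ger0_norm ?invr_ge0; last by lra.
  by rewrite invf_lt1; lra.
Unshelve. all: by end_near. Qed.

End step_polynomials.

Section Fourier_uniqueness.
Context (R : realType).
Notation lam := (@circle_measure R).
Notation mu := (@lebesgue_measure R).

Let mI : measurable (`[0, 1[%classic : set (measurableTypeR R)).
Proof. exact: measurable_itv. Qed.

Lemma circle_measure_negligible (N : set (measurableTypeR R)) :
  mu.-negligible N -> lam.-negligible N.
Proof.
move=> [A [mA A0 NA]]; exists A; split => //.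
apply/eqP; rewrite eq_le measure_ge0 andbT -A0.
by rewrite circle_measureE le_measure// inE//; exact: measurableI.
Qed.

Lemma Rintegral_circle (g : R -> R) : bmeas g ->
  \int[lam]_t g t = \int[mu]_t (g \_ `[0, 1[) t.
Proof.
move=> bg; rewrite -Rintegral_mkcond; congr fine.
have N0 : lam (~` (`[0, 1[%classic : set (measurableTypeR R))) = 0%E.
  by rewrite circle_measureE setICl measure0.
rewrite (negligible_integral (measurableC mI) measurableT _ N0); last first.
  exact: bmeas_finite_integrable.
rewrite setTD setCK; apply: eq_measure_integral => A mA AI.
exact: (congr1 mu (setIidl AI)).
Qed.

Lemma circle_integrable (g : R -> R) : bmeas g ->
  mu.-integrable setT (EFin \o (g \_ `[0, 1[)).
Proof.
move=> [mg [M gM]]; rewrite -restrict_EFin; apply/integrable_restrict => //.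
rewrite setTI; apply: measurable_bounded_integrable => //.
- have : (mu `[0%R, 1%R[%classic < +oo)%E.
    by rewrite lebesgue_measure_itv/= lte01 sube0 ltry.
  exact.
- exact: measurable_funS mg.
- exists M; split; first exact: num_real.
  by move=> N MN x _; exact: le_trans (gM x) (ltW MN).
Qed.

Lemma ae_circle_neq (x : R) : {ae lam, forall t, t != x}.
Proof.
apply: circle_measure_negligible; exists [set x]; split => //.
  exact: lebesgue_measure_set1.
by move=> t /= /negP; rewrite negbK => /eqP.
Qed.

(** The primitive of [h] vanishes, and by Lebesgue's differentiation theorem its
derivative is [h] almost everywhere. *)
Lemma ae_eq0_of_intervals (h : R -> R) : bmeas h ->
  (forall b, 0 <= b <= 1 -> \int[lam]_t (h t * \1_(`]-oo, b] : set R) t) = 0) ->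
  {ae lam, forall t, h t = 0}.
Proof.
move=> bh h0; pose f := h \_ `[0, 1[.
have intf : mu.-integrable setT (EFin \o f) by exact: circle_integrable.
have F0 : (fun y : R => \int[mu]_(t in `]-oo, y]) f t) = cst 0.
  apply/funext => y.
  have bhy b :
      bmeas (fun t : measurableTypeR R => h t * \1_(`]-oo, b] : set R) t).
    by apply: bmeasM => //; apply: bmeas_indic; exact: measurable_itv.
  transitivity (\int[lam]_t (h t * \1_(`]-oo, y] : set R) t)).
    rewrite [LHS]Rintegral_mkcond Rintegral_circle; last exact: bhy.
    apply: eq_Rintegral => t _.
    rewrite /f !patchE indicE; case: (t \in `[0, 1[%classic) => //.
      by case: (t \in `]-oo, y]%classic); rewrite ?mulr1 ?mulr0.
    by case: ifP.
  (* Up to the null point [0], only the part of [y] in the unit interval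
     matters. *)
  pose b := Num.max 0 (Num.min y 1).
  have b01 : 0 <= b <= 1.
    by rewrite le_max lexx/= ge_max ler01/= ge_min lexx orbT.
  rewrite [RHS]/= -(h0 b b01); apply: ae_eq_Rintegral => //.
  have := @ae_circle R; have := ae_circle_neq 0.
  apply: filterS2; first exact: (ae_filter_ringOfSetsType lam).
  move=> t tN0 /andP[t0 t1].
  have {}t0 : 0 < t by rewrite lt_neqAle eq_sym tN0.
  rewrite !indicE; congr (_ * (_ : bool)%:R).
  apply/idP/idP; rewrite !inE/= !in_itv/= /b.
    by move=> ty; rewrite le_max le_min ty (ltW t1) orbT.
  by rewrite le_max leNgt t0/= le_min => /andP[].
have intfy y : mu.-integrable `]-oo, y]%classic (EFin \o f).
  by apply: integrableS intf => //; exact: measurable_itv.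
have := FTC1Ny intfy (open_integrable_locally openT intf).
rewrite F0 => dF; have {dF} : {ae mu, forall t, f t = 0}.
  apply: filterS dF; first exact: (ae_filter_ringOfSetsType mu).
  by move=> t [_ <-]; exact: derive1_cst.
move=> /circle_measure_negligible f0.
have {}f0 : {ae lam, forall t, f t = 0} by [].
have := @ae_circle R; apply: filterS2 f0.
  exact: (ae_filter_ringOfSetsType lam).
move=> t ft t01.
by move: ft; rewrite /f patchE mem_set//= in_itv.
Qed.

End Fourier_uniqueness.

Section trigonometric_moments.
Context (R : realType).
Notation lam := (@circle_measure R).
Local Notation M := (measurableTypeR R).

Lemma bmeas_cosine (a : R) : bmeas (fun t : M => cos (2 * pi * (t - a))).
Proof.
have [b _] := @cbmeas_expi2pi R 1.
have -> : (fun t : M => cos (2 * pi * (t - a))) =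
    (fun t : M => complex.Re (expi2pi (1 * (t - a)))).
  by apply/funext => t; rewrite mul1r.
apply: (bmeas_comp (phi := fun t : M => t - a : M)) b.
exact: measurable_funB.
Qed.

Lemma bmeas_horner d (T : measurableType d) (c : T -> R) (p : {poly R}) :
  bmeas c -> bmeas (fun t => p.[c t]).
Proof.
move=> bc; elim/poly_ind: p => [|p a ih].
  by under eq_fun do rewrite horner0; exact: bmeas_cst.
under eq_fun do rewrite hornerMXaddC.
by apply: bmeasD; [exact: bmeasM|exact: bmeas_cst].
Qed.

(** For [0 <= b <= 1], the product form [arc_polyE] shows that this is positive on
the arc from [0] to [b] and negative on the complementary arc. *)
Definition arc_poly (b t : R) : R :=
  cos (2 * pi * (t - b / 2)) - cos (pi * b).

Lemma arc_polyE b t : arc_poly b t = 2 * sin (pi * t) * sin (pi * (b - t)).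
Proof.
rewrite /arc_poly.
have -> : 2 * pi * (t - b / 2) = pi * t - pi * (b - t) by field.
have -> : pi * b = pi * t + pi * (b - t) by ring.
by rewrite cosB cosD; ring.
Qed.

Lemma arc_poly_gt0 b t : b <= 1 -> 0 < t < b -> 0 < arc_poly b t.
Proof.
move=> b1 /andP[t0 tb]; rewrite arc_polyE.
by rewrite !mulr_gt0// sin_pi_gt0//; apply/andP; split; lra.
Qed.

Lemma arc_poly_lt0 b t : 0 <= b -> b < t < 1 -> arc_poly b t < 0.
Proof.
move=> b0 /andP[bt t1]; rewrite arc_polyE.
rewrite (_ : b - t = - (t - b)); last by ring.
rewrite mulrN sinN mulrN oppr_lt0.
by rewrite !mulr_gt0// sin_pi_gt0//; apply/andP; split; lra.
Qed.

(** Being affine in a cosine, [arc_poly b] may be substituted into the step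
polynomials; the limit is the indicator of an arc, and dominated convergence
applies. *)
Lemma ae_eq0_of_cosine_moments (h : R -> R) : bmeas h ->
  (forall b (p : {poly R}),
    \int[lam]_t (h t * p.[cos (2 * pi * (t - b))]) = 0) ->
  {ae lam, forall t, h t = 0}.
Proof.
move=> bh hp; apply: ae_eq0_of_intervals => // b /andP[b0 b1].
(* As [arc_poly b] has values in [[-2, 2]], this has values in [[0, 1]], and the
   sign changes become crossings of [1/2]. *)
pose x t : R := 2^-1 + arc_poly b t / 4.
have x01 t : 0 <= x t <= 1.
  have := cos_le1 (2 * pi * (t - b / 2)).
  have := cos_geN1 (2 * pi * (t - b / 2)).
  have := cos_le1 (pi * b); have := cos_geN1 (pi * b).
  by rewrite /x /arc_poly; move=> h1 h2 h3 h4; apply/andP; split; lra.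
pose q n : {poly R} :=
  (1 - (2^-1%:P + ('X - (cos (pi * b))%:P) * 4^-1%:P) ^+ n) ^+ (2 ^ n).
have qE n t : (q n).[cos (2 * pi * (t - b / 2))] = step n (x t).
  by rewrite /q /step !(hornerE, horner_exp).
have bx : bmeas (x : M -> R).
  apply: bmeasD; first exact: bmeas_cst.
  apply: bmeasM; last exact: bmeas_cst.
  by apply: bmeasB; [exact: bmeas_cosine|exact: bmeas_cst].
have bstep n : bmeas (fun t : M => step n (x t)).
  apply: bmeasX; apply: bmeasB; [exact: bmeas_cst|exact: bmeasX].
have bind : bmeas (\1_(`]-oo, b]%classic : set M) : M -> R).
  by apply: bmeas_indic; exact: measurable_itv.
have [mh [C hC]] := bh.
have C0 : 0 <= C by apply: le_trans (hC 0).
pose g (t : M) := h t * (1 - \1_(`]-oo, b]%classic : set M) t).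
have bg : bmeas g by apply: bmeasM => //; apply: bmeasB => //; exact: bmeas_cst.
pose gn n (t : M) := (h t * step n (x t))%:E.
have [] := @dominated_convergence _ _ _ lam setT measurableT gn (EFin \o g)
  (cst C%:E).
- by move=> n; apply/measurable_EFinP; have [] := bmeasM bh (bstep n).
- by apply/measurable_EFinP; case: bg.
- have c1 := @ae_circle R.
  have c2 := ae_circle_neq b; have c3 := ae_circle_neq (0 : R).
  apply: filterS3 c1 c2 c3; first exact: (ae_filter_ringOfSetsType lam).
  move=> t /andP[t0 t1] tb tN0 _.
  have {}t0 : 0 < t by rewrite lt_neqAle eq_sym tN0.
  apply: cvg_EFin; first by apply: nearW => n.
  rewrite /gn /= /g; apply: cvgM; first exact: cvg_cst.
  have /andP[xt0 xt1] := x01 t; rewrite indicE.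
  have [tltb|bltt] := ltP t b.
    rewrite mem_set/= ?in_itv/= ?(ltW tltb)// subrr.
    apply: step_cvg0; rewrite xt1 andbT /x.
    have := arc_poly_gt0 b1 (t := t); rewrite t0 tltb => /(_ isT); lra.
  have {}bltt : b < t by rewrite lt_neqAle eq_sym tb.
  rewrite memNset/= ?subr0; last by rewrite in_itv/= leNgt bltt.
  apply: step_cvg1; rewrite xt0 /x.
  have := arc_poly_lt0 b0 (t := t); rewrite bltt t1 => /(_ isT); lra.
- exact: (bmeas_finite_integrable lam (bmeas_cst _ C)).
- apply: nearW => t n _; rewrite /gn lee_fin normrM -[leRHS]mulr1.
  apply: ler_pM => //; have /andP[s0 s1] := step_itv n (x01 t).
  by rewrite ger0_norm.
move=> _ _; have -> : [sequence (\int[lam]_t gn n t)%E]_n = cst 0%E.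
  apply/funext => n /=; rewrite -[LHS]fineK; last first.
    apply: integrable_fin_num => //.
    exact: (bmeas_finite_integrable lam (bmeasM bh (bstep n))).
  congr EFin; rewrite -(hp (b / 2) (q n)).
  by congr fine; apply: eq_integral => t _; rewrite qE.
move=> /(cvg_unique _ (cvg_cst _)) g0.
have {g0} : \int[lam]_t g t = 0 by rewrite /Rintegral -g0.
have h0 : \int[lam]_t h t = 0.
  rewrite -(hp 0 1); apply: eq_Rintegral => t _.
  by rewrite hornerC mulr1.
under eq_Rintegral do rewrite /g mulrBr mulr1.
rewrite RintegralB//; [|exact: bmeas_finite_integrable|]; last first.
  by apply: bmeas_finite_integrable; exact: bmeasM.
by rewrite h0 sub0r => /eqP; rewrite oppr_eq0 => /eqP.
Qed.

(** A cosine is a combination of the characters of index [1] and [-1], so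
multiplying by it preserves the vanishing of all Fourier coefficients; hence so
does multiplying by a polynomial in it. *)
Theorem Fourier_uniqueness (f : R -> R[i]) : cbmeas f ->
  (forall k : int, cint lam (fun t => f t * expi2pi (k%:~R * t)) = 0) ->
  {ae lam, forall t, f t = 0}.
Proof.
move=> bf f0.
have ce b t : (cos (2 * pi * (t - b)))%:C =
    2^-1 * expi2pi (- b) * expi2pi (1%:~R * t) +
    2^-1 * expi2pi b * expi2pi ((- 1)%:~R * t).
  rewrite -!mulrA -!expi2piD -mulrDr mul1r mulN1r.
  rewrite (_ : - b + t = t - b); last by ring.
  rewrite (_ : b - t = - (t - b)); last by ring.
  rewrite /expi2pi mulrN cosN sinN; simpc.
  by rewrite mulrA; congr (_ +i* _); field.
have bp b p : cbmeas (fun t : M => f t * (p.[cos (2 * pi * (t - b))])%:C).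
  apply: cbmeasM => //; apply: cbmeas_real; apply: bmeas_horner.
  exact: bmeas_cosine.
have key b (p : {poly R}) (k : int) : cint lam
    (fun t => f t * (p.[cos (2 * pi * (t - b))])%:C * expi2pi (k%:~R * t)) = 0.
  elim/poly_ind: p k => [|p a ih] k.
    under eq_fun do rewrite horner0 mulr0 mul0r.
    by rewrite /cint /= !Rintegral_cst// !mul0r.
  have be l : cbmeas (fun t : M =>
      f t * (p.[cos (2 * pi * (t - b))])%:C * expi2pi (l%:~R * t)).
    by apply: cbmeasM => //; exact: cbmeas_expi2pi.
  transitivity (cint lam (fun t : M =>
    2^-1 * expi2pi (- b) *
      (f t * (p.[cos (2 * pi * (t - b))])%:C * expi2pi ((k + 1)%:~R * t)) +
    (2^-1 * expi2pi b *
      (f t * (p.[cos (2 * pi * (t - b))])%:C * expi2pi ((k - 1)%:~R * t)) +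
    a%:C * (f t * expi2pi (k%:~R * t))))).
    congr cint; apply/funext => t.
    have -> : ((p * 'X + a%:P).[cos (2 * pi * (t - b))])%:C =
        (p.[cos (2 * pi * (t - b))])%:C * (cos (2 * pi * (t - b)))%:C + a%:C.
      by rewrite hornerMXaddC rmorphD rmorphM.
    by rewrite ce !intrD !mulrDl !expi2piD; ring.
  have bk : cbmeas (fun t : M => f t * expi2pi (k%:~R * t)).
    by apply: cbmeasM => //; exact: cbmeas_expi2pi.
  have bZ c (g : M -> R[i]) : cbmeas g -> cbmeas (fun t => c * g t).
    by move=> bg; apply: cbmeasM => //; exact: cbmeas_cst.
  rewrite cintD; [|exact: bZ|by apply: cbmeasD; exact: bZ].
  rewrite cintD; [|exact: bZ|exact: bZ].
  by rewrite !cintZ// !ih f0 !mulr0 !addr0.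
have key0 b (p : {poly R}) :
    cint lam (fun t => f t * (p.[cos (2 * pi * (t - b))])%:C) = 0.
  rewrite -[RHS](key b p 0); congr cint; apply/funext => t.
  by rewrite mul0r expi2pi0 mulr1.
have re0 : {ae lam, forall t, complex.Re (f t) = 0}.
  apply: ae_eq0_of_cosine_moments; first by case: bf.
  move=> b p; have := congr1 (@complex.Re R) (key0 b p); rewrite /cint/=.
  by under eq_Rintegral do rewrite complex_ReM/= mulr0 subr0.
have im0 : {ae lam, forall t, complex.Im (f t) = 0}.
  apply: ae_eq0_of_cosine_moments; first by case: bf.
  move=> b p; have := congr1 (@complex.Im R) (key0 b p); rewrite /cint/=.
  by under eq_Rintegral do rewrite complex_ImM/= mulr0 add0r.
apply: filterS2 re0 im0; first exact: (ae_filter_ringOfSetsType lam).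
by move=> t; case: (f t) => x y /= -> ->.
Qed.

End trigonometric_moments.

(** * Eigenfunctions of maps over a translation of the torus *)

Lemma measurable_cbmeas_neq0 d (T : measurableType d) (R : realType)
    (f : T -> R[i]) :
  cbmeas f -> measurable [set x | f x != 0].
Proof.
move=> [[mr _] [mi _]].
have -> : [set x | f x != 0] =
    (fun x => complex.Re (f x)) @^-1` (~` [set 0]) `|`
    (fun x => complex.Im (f x)) @^-1` (~` [set 0]).
  apply/seteqP; split => x /=.
    rewrite eq_complex/= negb_and => /orP[/eqP ?|/eqP ?]; [by left|by right].
  by rewrite eq_complex/= negb_and => -[/eqP ->|/eqP ->]; rewrite ?orbT.
by apply: measurableU; rewrite -[X in measurable X]setTI;
  [apply: mr|apply: mi] => //; apply: measurableC; exact: measurable_set1.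
Qed.

(** If some value [alpha] were not zero, a polynomial vanishing at zero and at
all the values but [alpha] would have a sum of values that is a nonzero
multiple of its value at [alpha], and yet a combination of the power sums. *)
Lemma power_sums_eq0 (R : realType) (I : finType) (z : I -> R[i]) :
  (forall j : nat, (0 < j)%N -> \sum_i z i ^+ j = 0) -> forall i, z i = 0.
Proof.
move=> z0 i0; apply/eqP/negPn/negP => zi0.
pose r : {poly R[i]} := \prod_(i | z i != z i0) ('X - (z i)%:P).
have sr : \sum_i z i * r.[z i] = 0.
  under eq_bigr do rewrite horner_coef mulr_sumr.
  rewrite exchange_big/= big1// => k _.
  under eq_bigr do rewrite mulrCA -exprS.
  by rewrite -mulr_sumr z0// mulr0.
move: sr.
rewrite (bigID (fun i => z i == z i0))/= [X in _ + X]big1 ?addr0; last first.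
  move=> i zi.
  by rewrite /r horner_prod (bigD1 i)//= hornerXsubC subrr mul0r mulr0.
rewrite (eq_bigr (fun=> z i0 * r.[z i0])); last by move=> i /eqP ->.
rewrite sumr_const => /eqP; rewrite mulrn_eq0 mulf_eq0 (negbTE zi0)/=.
case/orP => [|/eqP r0].
  rewrite -leqn0 leqNgt => /negP; apply.
  by apply/card_gt0P; exists i0; exact: eqxx.
have : r.[z i0] != 0.
  rewrite /r horner_prod; apply/prodf_neq0 => i zi.
  by rewrite !hornerE subr_eq0 eq_sym.
by rewrite r0 eqxx.
Qed.

Section eigenfunctions.
Context (R : realType) (n : nat).
Notation lam := (@circle_measure R).
Local Notation M := (measurableTypeR R).

(** Lebesgue measure on [n.+1] disjoint unit squares, as an iterated product of
finite measures. *)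
Definition squares_measure :=
  finite_prod (finite_prod (@card_measure R n) lam) lam.
HB.instance Definition _ := FiniteMeasure.on squares_measure.

Variables (S : 'I_n.+1 * M * M -> 'I_n.+1 * M * M) (v1 v2 theta : R).
Hypothesis mS : measurable_fun setT S.
Hypothesis S_preserving : forall A, measurable A ->
  squares_measure (S @^-1` A) = squares_measure A.
Hypothesis S_translation : {ae squares_measure, forall p,
  (S p).1.2 = frac (p.1.2 + v1) /\ (S p).2 = frac (p.2 + v2)}.
Hypothesis theta_free : forall (j : nat) (k1 k2 : int), (0 < j)%N ->
  expi2pi (j%:R * theta + (k1%:~R * v1 + k2%:~R * v2)) <> 1.

(** The product of [a ^+ j] with a character of the two coordinates is
multiplied by a constant other than [1] under [S], so its integral is zero.
Hence for [0 < j] the sum of [a ^+ j] over the squares, a function on the torus,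
has no nonzero Fourier coefficient and vanishes almost everywhere; as all the
power sums vanish, so does [a]. *)
Lemma eigenfunction_eq0 (a : 'I_n.+1 * M * M -> R[i]) : cbmeas a ->
  {ae squares_measure, forall p, a (S p) = expi2pi theta * a p} ->
  {ae squares_measure, forall p, a p = 0}.
Proof.
move=> ba aS.
pose phi (j : nat) (k1 k2 : int) (p : 'I_n.+1 * M * M) :=
  a p ^+ j * expi2pi (k1%:~R * p.1.2) * expi2pi (k2%:~R * p.2).
have m2 : measurable_fun setT (fun p : 'I_n.+1 * M * M => p.1.2).
  exact: (measurableT_comp measurable_snd measurable_fst).
have bphi1 j k1 : cbmeas (fun p => a p ^+ j * expi2pi (k1%:~R * p.1.2)).
  apply: cbmeasM; first exact: cbmeasX.
  exact: (cbmeas_comp m2 (cbmeas_expi2pi _)).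
have bphi j k1 k2 : cbmeas (phi j k1 k2).
  apply: cbmeasM => //.
  exact: (cbmeas_comp measurable_snd (cbmeas_expi2pi _)).
have phi0 j k1 k2 : (0 < j)%N -> cint squares_measure (phi j k1 k2) = 0.
  move=> j0; set c := expi2pi (j%:R * theta + (k1%:~R * v1 + k2%:~R * v2)).
  have : cint squares_measure (phi j k1 k2) =
      c * cint squares_measure (phi j k1 k2).
    rewrite -cintZ//.
    rewrite -[LHS](cint_measure_preserving mS S_preserving (bphi _ _ _)).
    apply: ae_eq_cint.
    - exact: cbmeas_comp mS (bphi _ _ _).
    - by apply: cbmeasM => //; exact: cbmeas_cst.
    apply: filterS2 aS S_translation => p ap [p1 p2].
    rewrite /phi ap p1 p2 !expi2pi_frac !mulrDr !expi2piD exprMn expi2piX.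
    by rewrite /c !expi2piD; ring.
  move/eqP; rewrite -subr_eq0 -{1}[cint _ _]mul1r -mulrBl mulf_eq0 subr_eq0.
  by case/orP => /eqP // /esym /theta_free.
have G0 : {ae lam, forall y2, forall jk : nat * int,
    cint (finite_prod (@card_measure R n) lam)
      (fun q => a (q, y2) ^+ jk.1.+1 * expi2pi (jk.2%:~R * q.2)) = 0}.
  apply: ae_forall_count => -[j k1] /=.
  apply: Fourier_uniqueness.
    exact: (cbmeas_cint2 (finite_prod (@card_measure R n) lam) lam
      (bphi1 j.+1 k1)).
  move=> k2; rewrite -[RHS](phi0 j.+1 k1 k2 isT) cint_prod2//.
  congr cint; apply/funext => y2; rewrite mulrC -cintZ;
    last exact: (cbmeas_section2 (bphi1 j.+1 k1) y2).
  by congr cint; apply/funext => q; rewrite mulrC.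
have N0 : squares_measure [set p | a p != 0] = 0%E.
  apply: negligible_prod2; first exact: measurable_cbmeas_neq0.
  apply: filterS G0 => y2 G0.
  suff : {ae finite_prod (@card_measure R n) lam, forall q, a (q, y2) = 0}.
    by apply: filterS => q /= ->; rewrite eqxx.
  have bay : cbmeas (fun q => a (q, y2)) by exact: cbmeas_section2.
  have H0 : {ae lam, forall y1, forall j : nat,
      \sum_c a (c, y1, y2) ^+ j.+1 = 0}.
    apply: ae_forall_count => j.
    have bj := cbmeasX j.+1 bay.
    have := cbmeas_cint2 (@card_measure R n) lam bj.
    under eq_fun do rewrite cint_card.
    move/Fourier_uniqueness; apply => k1.
    rewrite -[RHS](G0 (j, k1)) cint_prod2/=; last first.
      apply: cbmeasM => //.
      exact: (cbmeas_comp measurable_snd (cbmeas_expi2pi _)).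
    by congr cint; apply/funext => y1; rewrite cint_card mulr_suml.
  exists [set q | a (q, y2) != 0]; split.
  - exact: measurable_cbmeas_neq0.
  - apply: negligible_prod2; first exact: measurable_cbmeas_neq0.
    apply: filterS H0 => y1 H0; apply: nearW => c /=.
    rewrite (@power_sums_eq0 _ _ (fun c => a (c, y1, y2)) _ c) ?eqxx//.
    by case=> // j _; exact: H0.
  - by move=> q /= /eqP.
exists [set p | a p != 0]; split => //; first exact: measurable_cbmeas_neq0.
by move=> p /= /eqP.
Qed.

End eigenfunctions.

(** * Skew products with rotations of the circle *)

Lemma ae_circle_ex (R : realType) (Q : R -> Prop) :
  {ae @circle_measure R, forall t, Q t} -> exists t, Q t.
Proof.
move=> [N [mN N0 QN]]; apply: contrapT => /forallNP nQ.
have : circle_measure N = 1%E :> \bar R.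
  rewrite (_ : N = setT) ?circle_measureT//.
  by apply/seteqP; split => // t _; exact/QN/nQ.
by rewrite N0 => /eqP; rewrite lt_eqF// lte01.
Qed.

Section skew_product.
Context d (X : measurableType d) (R : realType)
  (mu : {finite_measure set X -> \bar R}).
Notation lam := (@circle_measure R).
Local Notation M := (measurableTypeR R).
Variables (S : X -> X) (w : R).

Definition skew_rotation (p : X * M) : X * M := (S p.1, frac (p.2 + w)).

Lemma measurable_skew_rotation :
  measurable_fun setT S -> measurable_fun setT skew_rotation.
Proof.
move=> mS; apply/measurable_fun_pairP; split => /=.
  exact: (measurableT_comp mS measurable_fst).
apply: (measurableT_comp (@measurable_frac R)).
by apply: measurable_funD => //; exact: measurable_snd.
Qed.

Lemma skew_rotation_preserving : measurable_fun setT S ->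
  (forall A, measurable A -> mu (S @^-1` A) = mu A) ->
  forall A, measurable A ->
    finite_prod mu lam (skew_rotation @^-1` A) = finite_prod mu lam A.
Proof.
move=> mS muS A mA.
have bA := bmeas_indic R mA.
have mT := measurable_skew_rotation mS.
have mTA : measurable (skew_rotation @^-1` A).
  by rewrite -[X in measurable X]setTI; exact: mT.
have bTA := bmeas_indic R mTA.
have finite_inj B C : measurable B -> measurable C ->
    fine (finite_prod mu lam B) = fine (finite_prod mu lam C) ->
    finite_prod mu lam B = finite_prod mu lam C.
  move=> mB mC h; rewrite -[LHS]fineK ?h ?fineK//; exact: fin_num_measure.
apply: finite_inj => //; rewrite -!Rintegral_indic// !Rintegral_prod1//.
rewrite -[RHS](Rintegral_measure_preserving mS muS
  (bmeas_Rintegral1 mu lam bA)).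
apply: eq_Rintegral => x _.
have mfw : measurable_fun setT (fun t : M => frac (t + w) : M).
  by apply: (measurableT_comp (@measurable_frac R)); exact: measurable_funD.
rewrite -[RHS](Rintegral_measure_preserving mfw (@circle_measure_rotate R w)
  (bmeas_section1 bA (S x))).
by apply: eq_Rintegral => z _; rewrite !indicE.
Qed.

(** Let [A] be an invariant set. As functions of the base point, the Fourier
coefficients of the fibres of [A] are eigenfunctions of [S], so by hypothesis
all but the mean vanish. Almost every fibre is thus null or of full measure, and
the base points of the fibres of full measure form an invariant set of [S]. *)
Theorem ergodic_skew_rotation : ergodic mu S ->
  (forall (k : int) (a : X -> R[i]), k != 0 -> cbmeas a ->
    {ae mu, forall x, a (S x) = expi2pi (k%:~R * w) * a x} ->
    {ae mu, forall x, a x = 0}) ->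
  ergodic (finite_prod mu lam) skew_rotation.
Proof.
move=> [mS muS ergS] no_eigen; split.
- exact: measurable_skew_rotation.
- exact: skew_rotation_preserving.
move=> A mA invA; have bA := bmeas_indic R mA.
pose F p : R[i] := (\1_A p : R)%:C.
have bF : cbmeas F by exact: cbmeas_real.
pose a (k : int) x := cint lam (fun z => F (x, z) * expi2pi (k%:~R * z)).
have bFe k : cbmeas (fun p : X * M => F p * expi2pi (k%:~R * p.2)).
  apply: cbmeasM => //.
  exact: (cbmeas_comp measurable_snd (cbmeas_expi2pi _)).
have ba k : cbmeas (a k) by exact: (cbmeas_cint1 mu lam (bFe k)).
have aS k : {ae mu, forall x, a k (S x) = expi2pi (k%:~R * w) * a k x}.
  apply: filterS (ae_prod1 invA) => x Ax.
  have bg := cbmeas_section1 (bFe k) (S x).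
  have bh := cbmeas_section1 (bFe k) x.
  rewrite /a -(cint_circle_rotate w bg) -cintZ//.
  have mfw : measurable_fun setT (fun t : M => frac (t + w) : M).
    by apply: (measurableT_comp (@measurable_frac R)); exact: measurable_funD.
  apply: ae_eq_cint.
  - exact: (cbmeas_comp mfw bg).
  - by apply: cbmeasM => //; exact: cbmeas_cst.
  apply: filterS Ax => z Axz.
  rewrite /= expi2pi_frac mulrDr expi2piD /F !indicE.
  have -> : ((S x, frac (z + w)) \in A) = ((x, z) \in A).
    by apply/idP/idP; rewrite !inE => /Axz.
  by ring.
pose m x : R := \int[lam]_z \1_A (x, z).
have bm : bmeas m by exact: (bmeas_Rintegral1 mu lam bA).
have a0E x : a 0 x = (m x)%:C.
  rewrite /a; under eq_fun do rewrite mul0r expi2pi0 mulr1.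
  by rewrite /cint /F /= Rintegral_cst// mul0r.
have mS' : {ae mu, forall x, m (S x) = m x}.
  by apply: filterS (aS 0) => x; rewrite mul0r expi2pi0 mul1r !a0E => /complexI.
have fibre : {ae mu, forall x, {ae lam, forall z, \1_A (x, z) = m x}}.
  have : {ae mu, forall x, forall k : int, k != 0 -> a k x = 0}.
    apply: ae_forall_count => k; have [->|k0] := eqVneq k 0; first exact: nearW.
    by apply: filterS (no_eigen k (a k) k0 (ba k) (aS k)).
  apply: filterS => x a0.
  have bFx : cbmeas (fun z => F (x, z)) by exact: cbmeas_section1.
  have bFm : cbmeas (fun z : M => F (x, z) + - (m x)%:C).
    by apply: cbmeasD => //; exact: cbmeas_cst.
  have : {ae lam, forall z, F (x, z) + - (m x)%:C = 0}.
    apply: Fourier_uniqueness => // k.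
    under eq_fun do rewrite mulrDl.
    have be := @cbmeas_expi2pi R k%:~R.
    rewrite cintD; [|exact: cbmeasM|by apply: cbmeasM => //; exact: cbmeas_cst].
    rewrite cintZ// -/(a k x).
    have [->|k0] := eqVneq k 0; last by rewrite a0// cint_expi2pi// mulr0 addr0.
    rewrite a0E; under eq_fun do rewrite mul0r expi2pi0.
    rewrite /cint/= !Rintegral_cst// mul0r.
    rewrite [X in fine X]circle_measureT/= mulr1.
    by rewrite mulr1 addrN.
  by apply: filterS => z /eqP; rewrite addr_eq0 opprK => /eqP /complexI.
have m01 : {ae mu, forall x, m x = 0 \/ m x = 1}.
  apply: filterS fibre => x /ae_circle_ex[z]; rewrite indicE.
  by case: (_ \in _) => <-; [right|left].
pose B := [set x | m x = 1].
have mB : measurable B.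
  have -> : B = m @^-1` [set 1] by [].
  by rewrite -[X in measurable X]setTI; case: bm => mm _; apply: mm.
have invB : {ae mu, forall x, B (S x) <-> B x}.
  by apply: filterS mS' => x; rewrite /B/= => ->.
have [B0|B0] := ergS B mB invB; [left|right].
- apply: negligible_prod1 => //.
  have nB : {ae mu, forall x, ~ B x} by exists B; split => // x /= /contrapT.
  apply: filterS3 nB m01 fibre => x nB [|//] m0.
  apply: filterS => z; rewrite m0 indicE => Az Axz.
  by move: Az; rewrite mem_set// => /eqP; rewrite oner_eq0.
- apply: negligible_prod1; first exact: measurableC.
  have nB : {ae mu, forall x, B x}.
    by exists (~` B); split => //; exact: measurableC.
  apply: filterS2 nB fibre => x Bx.
  apply: filterS => z; rewrite Bx indicE => Az; apply; apply: contrapT => nAxz.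
  by move: Az; rewrite memNset// => /eqP; rewrite eq_sym oner_eq0.
Qed.

End skew_product.

Lemma ergodic_eq_measure d (X : measurableType d) (R : realType)
    (mu nu : {measure set X -> \bar R}) (f : X -> X) :
  (forall A, measurable A -> mu A = nu A) -> ergodic mu f -> ergodic nu f.
Proof.
move=> munu [mf muf ergf]; split => // [A mA|A mA invA].
  by rewrite -!munu// ?muf// -[X in measurable X]setTI; exact: mf.
rewrite -!munu//; [|exact: measurableC]; apply: ergf => //.
by case: invA => N [mN N0 NA]; exists N; split; rewrite ?munu.
Qed.

(** Under the skew product, the preimage of a cylinder [A `*` setT] is the cylinder
over the preimage of [A] under [S]. *)
Lemma ergodic_base d (X : measurableType d) (R : realType)
    (mu : {finite_measure set X -> \bar R}) (S : X -> X) (w : R) :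
  ergodic (finite_prod mu (@circle_measure R)) (skew_rotation S w) ->
  ergodic mu S.
Proof.
move=> [mT muT ergT].
have cylinder A : measurable A ->
    finite_prod mu (@circle_measure R) (A `*` setT) = mu A.
  move=> mA.
  by rewrite finite_prodE// [X in (_ * X)%E](@circle_measureT R) mule1.
have mS : measurable_fun setT S.
  rewrite (_ : S = fst \o (skew_rotation S w) \o (fun x => (x, 0)))//.
  apply: measurableT_comp; last exact: pair2_measurable.
  exact: (measurableT_comp measurable_fst mT).
have mSA A : measurable A -> measurable (S @^-1` A).
  by move=> mA; rewrite -[X in measurable X]setTI; exact: mS.
split => //.
  move=> A mA; rewrite -[RHS]cylinder// -muT; last exact: measurableX.
  have -> : skew_rotation S w @^-1` (A `*` setT) = (S @^-1` A) `*` setT.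
    by apply/seteqP; split => -[x z] /= [].
  exact: (esym (cylinder _ (mSA A mA))).
move=> A mA [N [mN N0 NA]].
case: (ergT (A `*` setT) (measurableX mA measurableT)) => [|A0|A0].
- exists (N `*` setT); split.
  + exact: measurableX.
  + by rewrite -N0; exact: cylinder.
  + move=> [x z] /= h; split => //; apply: NA => /= h'; apply: h.
    by split=> -[/h' ? _]; split.
- by left; rewrite -A0; exact/esym/cylinder.
- right; rewrite -A0.
  transitivity (finite_prod mu (@circle_measure R) ((~` A) `*` setT)).
    by rewrite cylinder//; exact: measurableC.
  congr finite_prod.
  apply/seteqP; split => -[x z] /=; first by move=> [nA _] [].
  by move=> h; split => // Ax; exact: h.
Qed.

(** * Geodesics in coordinates *)

Section geodesics.
Context (R : realType) (P : polysquare).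
Implicit Types (u v : R * R) (g : R -> surface_point R P).

(** The truth value of [Q] is locally constant, and a segment is connected. *)
Lemma segment_induction (L : R) (Q : R -> Prop) : 0 <= L -> Q 0 ->
  (forall t, 0 <= t <= L -> \forall s \near t, 0 <= s <= L -> (Q s <-> Q t)) ->
  forall t, 0 <= t <= L -> Q t.
Proof.
move=> L0 Q0 locQ.
pose B := [set t | 0 <= t <= L /\ Q t].
suff BE : B = `[0, L]%classic.
  by move=> t tL; have : `[0, L]%classic t by []; rewrite -BE => -[].
apply: (@segment_connected R 0 L).
- by exists 0; split => //; rewrite lexx.
- exists (interior [set t | 0 <= t <= L -> Q t]); first exact: open_interior.
  apply/seteqP; split => t /=.
    move=> [tL Qt]; split => //; apply: filterS (locQ t tL) => s sQ sL.
    exact/(sQ sL).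
  by move=> [tL /nbhs_singleton Qt]; split => //; exact: Qt.
- exists (~` interior [set t | 0 <= t <= L -> ~ Q t]).
    exact/open_closedC/open_interior.
  apply/seteqP; split => t /=.
    by move=> [tL Qt]; split => // /nbhs_singleton /(_ tL).
  move=> [tL nQ]; split => //; apply: contrapT => nQt; apply: nQ.
  by apply: filterS (locQ t tL) => s sQ sL /(sQ sL).
Qed.

Lemma frac_subK (x y a : R) :
  frac x = x -> y = frac (x + a) -> x = frac (y - a).
Proof. by move=> {2}<- ->; rewrite frac_fracD addrK. Qed.

(** The definition of a geodesic prescribes the motion of its coordinates over
short times only; this extends it to the whole time interval. *)
Lemma coordinate_along (L u : R) (f : R -> R) : 0 <= L ->
  (forall t, 0 <= t <= L -> \forall s \near t, 0 <= s <= L ->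
    f s = frac (f t + (s - t) * u)) ->
  f L = frac (f 0 + L * u).
Proof.
move=> L0 flow.
have ffrac t : 0 <= t <= L -> frac (f t) = f t.
  move=> tL; have /nbhs_singleton /(_ tL) := flow t tL.
  by rewrite subrr mul0r addr0.
apply: (segment_induction (L := L)
  (Q := fun t => f t = frac (f 0 + t * u))) => //.
- by rewrite mul0r addr0 ffrac// lexx.
- move=> t tL; apply: filterS (flow t tL) => s fs sL; have {}fs := fs sL.
  split => [fs0|ft].
  + rewrite (frac_subK (ffrac t tL) fs) fs0 frac_fracD; congr frac; ring.
  + rewrite fs ft frac_fracD; congr frac; ring.
- by rewrite L0 lexx.
Qed.

Lemma shift_rel_coordinates v (p q : surface_point R P) : v.1 != 0 ->
  shift_rel v p q ->
  q.1.2 = frac (p.1.2 + v.1) /\ q.2 = frac (p.2 + v.2).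
Proof.
move=> v0 [g [geo g0 gL]]; set L := euclidean_norm v in geo gL.
have L0 : 0 < L.
  rewrite sqrtr_gt0 ltr_pwDl ?sqr_ge0// lt_neqAle eq_sym sqrf_eq0 v0.
  exact: sqr_ge0.
have LN0 : L != 0 by rewrite gt_eqF.
split.
- have := @coordinate_along L (v.1 / L) (fun t => (g t).1.2) (ltW L0).
  rewrite [L * _]mulrC divfK// g0 gL; apply => t /geo[_].
  apply: filterS => s /[apply] ->.
  by case: (g t) => [[c x] y].
- have := @coordinate_along L (v.2 / L) (fun t => (g t).2) (ltW L0).
  rewrite [L * _]mulrC divfK// g0 gL; apply => t /geo[_].
  apply: filterS => s /[apply] ->.
  by case: (g t) => [[c x] y].
Qed.

Lemma frac_eqD (x a : R) : x = frac (x + a) -> exists k : int, a = k%:~R.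
Proof.
rewrite /Defs.frac => h; exists (Num.floor (x + a)).
by move: h; set k : R := _%:~R; lra.
Qed.

Lemma surface_shift_fixed v (p : surface_point R P) :
  (forall k : int, v.1 != k%:~R) ->
  ((surface_shift v p).1.2 = p.1.2) <-> surface_shift v p = p.
Proof.
move=> v_int; split=> [|->//]; rewrite /surface_shift; case: xgetP => // q _.
move/shift_rel_coordinates => [|-> _]; first exact: (v_int 0).
by move=> /esym /frac_eqD[k vk]; have := v_int k; rewrite vk eqxx.
Qed.

Lemma surface_shift_moved v (p : surface_point R P) : v.1 != 0 ->
  surface_shift v p <> p ->
  (surface_shift v p).1.2 = frac (p.1.2 + v.1) /\
  (surface_shift v p).2 = frac (p.2 + v.2).
Proof.
move=> v0; rewrite {1}/surface_shift; case: xgetP => // q -> qP _.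
exact: shift_rel_coordinates.
Qed.

End geodesics.

(** * The measures of the surface and of the manifold *)

Section restricted_products.
Context d1 d2 (T1 : measurableType d1) (T2 : measurableType d2) (R : realType).

(** The area and the volume are restrictions of infinite product measures to
boxes; this turns them into iterated products of finite measures. *)
Lemma mrestr_prodE (m1 : {measure set T1 -> \bar R})
    (m2 : {sigma_finite_measure set T2 -> \bar R}) (D1 : set T1) (D2 : set T2)
    (n1 : {finite_measure set T1 -> \bar R})
    (n2 : {finite_measure set T2 -> \bar R})
    (mD1 : measurable D1) (mD2 : measurable D2) :
  (forall A, measurable A -> n1 A = m1 (A `&` D1)) ->
  (forall A, measurable A -> n2 A = m2 (A `&` D2)) ->
  forall A, measurable A ->
    finite_prod n1 n2 A = (m1 \x m2)%E (A `&` (D1 `*` D2)).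
Proof.
move=> n1E n2E.
have mD : measurable (D1 `*` D2) by exact: measurableX.
move=> X mX; transitivity (mrestr (m1 \x m2)%E mD X) => //.
apply: product_measure_unique mX => A B mA mB.
rewrite /= /mrestr -setXI product_measure1E//; try exact: measurableI.
by rewrite n1E// n2E.
Qed.

End restricted_products.

Section surface.
Context (R : realType) (P : polysquare).
Notation lam := (@circle_measure R).
Notation surf := (@squares_measure R (nsquares_pred P)).
Local Notation M := (measurableTypeR R).
Local Notation X := (square P * M * M)%type.

Let mI : measurable (`[0, 1[%classic : set M).
Proof. exact: measurable_itv. Qed.

Let mS1 : measurable ([set: square P] `*` (`[0, 1[%classic : set M)).
Proof. exact: measurableX. Qed.

Let columnE (A : set (square P * M)) : measurable A ->
  finite_prod (@card_measure R (nsquares_pred P)) lam A =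
  (@counting (square P) R \x @lebesgue_measure R)%E
    (A `&` ([set: square P] `*` `[0, 1[)).
Proof. by apply: mrestr_prodE => // B _; rewrite setIT. Qed.

Lemma area_squares (A : set X) : measurable A -> area R P A = surf A.
Proof.
by move=> mA; apply: esym; apply: mrestr_prodE mA => // B; exact: columnE.
Qed.

Lemma volume_cubes (A : set (X * M)) : measurable A ->
  volume R P A = finite_prod surf lam A.
Proof.
have areaE (B : set X) : measurable B -> surf B =
    (@counting (square P) R \x @lebesgue_measure R \x @lebesgue_measure R)%E
      (B `&` unit_squares R P).
  by move=> mB; exact: (esym (area_squares mB)).
move=> mA; apply: esym.
exact: (@mrestr_prodE _ _ _ _ _ _ (@lebesgue_measure R) _ _ _ lam
  (@measurable_unit_squares R P) mI areaE (fun B _ => erefl) A mA).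
Qed.

Lemma surf_strip (J : set M) : measurable J ->
  lebesgue_measure (J `&` `[0, 1[) != 0%E ->
  surf [set p | J p.1.2] != 0%E.
Proof.
move=> mJ J0.
have -> : [set p : X | J p.1.2] = ([set: square P] `*` J) `*` setT.
  by apply/seteqP; split => -[[c x] y] /=; [|case=> -[]].
have -> : surf (([set: square P] `*` J) `*` setT) =
    (card_measure R [set: square P] * lam J * lam setT)%E.
  rewrite -(@finite_prodE _ _ _ _ _ (@card_measure R _) lam)//.
  by apply: finite_prodE => //; exact: measurableX.
rewrite circle_measureT mule1 mule_eq0 negb_or J0 andbT.
apply/eqP => c0.
have : card_measure R [set ord0 : square P] = 0%E.
  by apply: (subset_measure0 (A := [set ord0]) (B := setT)) => //.
by rewrite card_measure1 => /eqP; rewrite eqe oner_eq0.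
Qed.

(** Every measurable set of fixed points is contained in its preimage, which has
the same measure, so it is invariant and is null or of full measure. The fixed
points with [x < 1/2] and those with [1/2 <= x] are not of full measure, as both
halves of the squares have positive measure; hence they are null. *)
Lemma ae_not_fixed (S : X -> X) : ergodic surf S ->
  measurable [set p | S p = p] -> {ae surf, forall p, S p <> p}.
Proof.
move=> [mS surfS ergS] mfix.
have mx : measurable_fun setT (fun p : X => p.1.2).
  exact: (measurableT_comp measurable_snd measurable_fst).
have half (J : set M) : measurable J ->
    lebesgue_measure (~` J `&` `[0, 1[) != 0%E ->
    surf ([set p | S p = p] `&` [set p | J p.1.2]) = 0%E.
  move=> mJ J0; set A := _ `&` _.
  have mAx : measurable [set p : X | J p.1.2].
    by rewrite -[Y in measurable Y]setTI; exact: mx.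
  have mA : measurable A by exact: measurableI.
  have mSA : measurable (S @^-1` A).
    by rewrite -[Y in measurable Y]setTI; exact: mS.
  have AS : A `<=` S @^-1` A by move=> p [pfix Jp]; rewrite /A /= !pfix.
  have [|//|nA0] := ergS A mA.
    exists (S @^-1` A `\` A); split; first exact: measurableD.
      rewrite measureD//; last exact: finite_measure_lty.
      rewrite setIidr// [X in (X - _)%E](surfS A mA) subee//.
      exact: fin_num_measure.
    move=> p /= h; split.
      by apply: contrapT => h'; apply: h; split => // Ap; exact/AS.
    by move=> Ap; apply: h; split => // _; exact: AS.
  have := surf_strip (measurableC mJ) J0; rewrite -measure_le0.
  move/negP; case; rewrite -nA0; apply: le_measure; rewrite ?inE.
  - by rewrite -[Y in measurable Y]setTI; apply: mx => //; exact: measurableC.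
  - exact: measurableC.
  - by move=> p /= nJ [].
exists [set p | S p = p]; split => //; last by move=> p /= /contrapT.
have -> : [set p | S p = p] =
    ([set p | S p = p] `&`
     [set p : X | (`]-oo, 2^-1[%classic : set M) p.1.2]) `|`
    ([set p | S p = p] `&`
     [set p : X | (~` `]-oo, 2^-1[%classic : set M) p.1.2]).
  by rewrite -setIUr (_ : _ `|` _ = setT) ?setIT// -subTset => p _; exact: EM.
have m2 : measurable (`]-oo, 2^-1[%classic : set M) by exact: measurable_itv.
apply/eqP; rewrite -measure_le0; apply: le_trans (measureU2 _ _ _) _.
- apply: measurableI => //; rewrite -[Y in measurable Y]setTI; exact: mx.
- apply: measurableI => //; rewrite -[Y in measurable Y]setTI; apply: mx => //.
  exact: measurableC.
rewrite [X in (X + _ <= _)%E](half _ m2)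
  ?[X in (_ + X <= _)%E](half _ (measurableC m2)) ?adde0//.
- rewrite setCK (_ : _ `&` _ = `[0, 2^-1[%classic); last first.
    apply/seteqP; split => t /=; rewrite !in_itv/=.
      by move=> [h1 /andP[h2 h3]]; rewrite h1 h2.
    by move=> /andP[h1 h2]; split => //; rewrite h1; lra.
  by rewrite lebesgue_measure_itv/= lte_fin invr_gt0 ltr0n/= sube0 eqe invr_eq0.
- rewrite (_ : _ `&` _ = `[2^-1, 1[%classic); last first.
    apply/seteqP; split => t /=; rewrite !in_itv/=.
      by move=> [/negP h1 /andP[h2 h3]]; rewrite leNgt h1.
    move=> /andP[h1 h2]; rewrite h2 andbT; split; last by lra.
    by apply/negP; rewrite -leNgt.
  rewrite lebesgue_measure_itv/= lte_fin ifT; last by lra.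
  by rewrite -EFinB eqe; apply/eqP; lra.
Qed.

(** The geodesics need not be constructed: a point without one is fixed by the
total map [surface_shift], so by ergodicity almost every point has one. *)
Lemma ae_shift_coordinates (v : R * R) :
  (forall k : int, v.1 != k%:~R) -> ergodic surf (@surface_shift R P v) ->
  {ae surf, forall p : X, (surface_shift v p).1.2 = frac (p.1.2 + v.1) /\
    (surface_shift v p).2 = frac (p.2 + v.2)}.
Proof.
move=> vint erg_v.
have : {ae surf, forall p : X, surface_shift v p <> p}.
  apply: ae_not_fixed => //; case: erg_v => mS _ _.
  have m1 : measurable_fun setT
      (fun p : X => (surface_shift v p).1.2 - p.1.2 : M).
    apply: measurable_funB.
      apply: (measurableT_comp measurable_snd).
      exact: (measurableT_comp measurable_fst mS).
    exact: (measurableT_comp measurable_snd measurable_fst).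
  rewrite (_ : [set p | _] =
    (fun p : X => (surface_shift v p).1.2 - p.1.2 : M) @^-1` [set 0]).
    by rewrite -[Y in measurable Y]setTI; apply: m1.
  apply/seteqP; split => p /=; first by move=> ->; rewrite subrr.
  by move/eqP; rewrite subr_eq0 => /eqP /(surface_shift_fixed _ vint).
apply: filterS => p; apply: surface_shift_moved; exact: (vint 0).
Qed.

End surface.

(** * Rational independence *)

Section rational_independence.
Context (R : realType).

Lemma independent_character (v1 v2 w : R) (j : nat) (k k1 k2 : int) :
  rat_independent [tuple v1; v2; w; 1] -> (0 < j)%N -> k != 0 ->
  expi2pi (j%:R * (k%:~R * w) + (k1%:~R * v1 + k2%:~R * v2)) <> 1.
Proof.
move=> ind j0 k0 /expi2pi_eq1[l lE].
pose q := [tuple k1%:~R; k2%:~R; j%:R * k%:~R; (- l)%:~R] : 4.-tuple rat.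
have /ind /(_ (inord 2)) :
    \sum_(i < 4) ratr (tnth q i) * tnth [tuple v1; v2; w; 1] i = 0.
  rewrite !big_ord_recl big_ord0 !(tnth_nth 0)/=.
  by rewrite rmorphM/= !ratr_int ratr_nat intrN -lE; ring.
move/eqP; rewrite (tnth_nth 0) inordK//=.
rewrite mulf_eq0 pnatr_eq0 intr_eq0 (negbTE k0) orbF.
by rewrite -leqn0 leqNgt j0.
Qed.

Lemma independent_first (v1 v2 : R) (k : int) :
  rat_independent [tuple v1; v2; 1] -> v1 != k%:~R.
Proof.
move=> ind; apply/eqP => v1k.
pose q := [tuple 1; 0; (- k)%:~R] : 3.-tuple rat.
have /ind /(_ (inord 0)) :
    \sum_(i < 3) ratr (tnth q i) * tnth [tuple v1; v2; 1] i = 0.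
  rewrite !big_ord_recl big_ord0 !(tnth_nth 0)/=.
  by rewrite rmorph1 rmorph0 ratr_int intrN -v1k; ring.
by move/eqP; rewrite (tnth_nth 0) inordK//= oner_eq0.
Qed.

(** The rational combinations of [v1], [v2] and [1] are countably many. *)
Lemma independent_extension (v1 v2 : R) : rat_independent [tuple v1; v2; 1] ->
  exists w : R, rat_independent [tuple v1; v2; w; 1].
Proof.
move=> ind.
pose span (q : rat * rat * rat) : R :=
  ratr q.1.1 * v1 + ratr q.1.2 * v2 + ratr q.2.
have [w wspan] : exists w, ~ range span w.
  apply/existsNP => all_span.
  have : lebesgue_measure [set: measurableTypeR R] = 0%E.
    rewrite (_ : setT = range span); last by apply/seteqP; split.
    apply: countable_lebesgue_measure0.
    exact: sub_countable (card_image_le _ _) (countableP _).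
  have : (lebesgue_measure (`[0%R, 1%R]%classic : set (measurableTypeR R)) <=
      lebesgue_measure [set: measurableTypeR R])%E.
    by apply: le_measure; rewrite ?inE//; exact: measurable_itv.
  rewrite lebesgue_measure_itv/= lte01 sube0 => /[swap] ->.
  by rewrite leNgt lte01.
exists w => q.
rewrite !big_ord_recl big_ord0 !(tnth_nth 0)/= addr0 mulr1.
set i1 := lift ord0 _; set i2 := lift ord0 _; set i3 := lift ord0 _ => q0.
have q2 : q i2 = 0.
  apply: contrapT => /eqP q2; apply: wspan.
  exists (- q ord0 / q i2, - q i1 / q i2, - q i3 / q i2) => //.
  have q2R : ratr (q i2) != 0 :> R by rewrite fmorph_eq0.
  rewrite /span/= !fmorph_div !rmorphN/=.
  apply: (mulfI q2R).
  transitivity (- (ratr (q ord0) * v1 + ratr (q i1) * v2 + ratr (q i3))).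
    by field.
  by rewrite -[LHS]addr0 -[X in _ + X = _]q0; ring.
pose q' := [tuple q ord0; q i1; q i3].
have /ind q'0 :
    \sum_(i < 3) ratr (tnth q' i) * tnth [tuple v1; v2; 1] i = 0.
  rewrite !big_ord_recl big_ord0 !(tnth_nth 0)/= addr0 mulr1 -[RHS]q0 q2.
  by rewrite rmorph0 mul0r add0r.
have := q'0 (inord 0); have := q'0 (inord 1); have := q'0 (inord 2).
rewrite !(tnth_nth 0) !inordK//= => q3 q1 qz i.
have [i2E|iN2] := eqVneq i i2; first by rewrite i2E.
case: i iN2 => -[|[|[|[|//]]]] /= lti iN2.
- by rewrite -[RHS]qz; congr (q _); apply: val_inj.
- by rewrite -[RHS]q1; congr (q _); apply: val_inj.
- by [].
- by rewrite -[RHS]q3; congr (q _); apply: val_inj.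
Qed.

End rational_independence.

Theorem theorem5 (R : realType) (P : polysquare) (v1 v2 : R)
    (Kronecker_v : rat_independent [tuple v1; v2; 1]) :
  ergodic (area R P) (@surface_shift R P (v1, v2)) <->
  (forall w : R, rat_independent [tuple v1; v2; w; 1] ->
    ergodic (volume R P) (@manifold_shift R P (v1, v2) w)).
Proof.
have vint (k : int) : (v1, v2).1 != k%:~R.
  exact: independent_first Kronecker_v.
split=> [erg_area w ind|erg_volume].
- have erg : ergodic (@squares_measure R (nsquares_pred P))
      (@surface_shift R P (v1, v2)).
    by apply: ergodic_eq_measure erg_area; exact: area_squares.
  apply: (ergodic_eq_measure (mu :=
    finite_prod (@squares_measure R (nsquares_pred P)) (@circle_measure R))).
    by move=> A mA; exact/esym/volume_cubes.
  rewrite (_ : manifold_shift _ w =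
    skew_rotation (@surface_shift R P (v1, v2)) w)//.
  apply: ergodic_skew_rotation => //.
  have Scoord := ae_shift_coordinates vint erg.
  case: erg => mS presS _ k a k0 ba.
  apply: (eigenfunction_eq0 mS presS Scoord) => //.
  by move=> j k1 k2 j0; exact: independent_character.
- have [w ind] := independent_extension Kronecker_v.
  apply: (ergodic_eq_measure (mu := @squares_measure R (nsquares_pred P))).
    by move=> A mA; exact/esym/area_squares.
  apply: (@ergodic_base _ _ _ _ _ w).
  by apply: ergodic_eq_measure (erg_volume w ind); exact: volume_cubes.
Qed.
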